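(* Let $m>2$, $n=2m$, and let $\xi^{A'}$ be a pure conformal Killing spinor on a $2m$-dimensional spin complex Riemannian manifold $(\mathcal M,g)$ with almost null structure $\mathcal N_\xi$. Set $\zeta^B=\frac{\sqrt2}{n}\gamma^a{}_{A'}{}^B\nabla_a\xi^{A'}$. Then $\xi^{A'}$ satisfies $$(\xi^{a(A}\nabla_a\xi^{bB)})\xi_b{}^{C}=0.$$ Further, $\xi^{A'}$ is geodetic, i.e. $\mathcal N_\xi$ is totally geodetic, if and only if $$\zeta^{aA'}\zeta_a{}^{B'}=0,\qquad \xi^{aB}\zeta_a{}^{A'}=-2\,\zeta^B\xi^{A'},\qquad(\ast)$$ i.e. $\zeta^A$, if non-zero, is pure and its almost null structure $\mathcal N_\zeta$ intersects $\mathcal N_\xi$ in a totally null $(m-1)$-plane at any point. Suppose that $\xi^{A'}$ is geodetic, so that $\zeta^A$ satisfies $(\ast)$. Then $\zeta^A$ satisfies $$\big(\zeta^{a[A'}\nabla_a\zeta^{bB'}\big)\zeta_b{}^{C']}=0.$$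
   Context: $(\mathcal M,g)$ is a complex manifold of dimension $n=2m$ with a non-degenerate holomorphic section $g_{ab}$ of $\odot^2T^*\mathcal M$ (holomorphic metric), a holomorphic volume form and a holomorphic spin structure; $\nabla_a$ is its holomorphic Levi-Civita connection and the induced spin connection. All fields are holomorphic. $\mathcal S^\pm$ are the chiral spinor bundles; sections of $\mathcal S^+$ have primed upper indices and of $\mathcal S^-$ unprimed ones. Clifford multiplication is given by ($\nabla$-parallel) $\gamma_{aA'}{}^B$, $\gamma_{aA}{}^{B'}$ with $\gamma_{(a|A'}{}^{C}\gamma_{|b)C}{}^{B'}=-g_{ab}\delta_{A'}^{B'}$, $\gamma_{(a|A}{}^{C'}\gamma_{|b)C'}{}^{B}=-g_{ab}\delta_A^B$. Brackets denote normalised (skew-)symmetrisation. Put $\xi_a{}^A:=\xi^{B'}\gamma_{aB'}{}^A$ and $\zeta_a{}^{A'}:=\zeta^B\gamma_{aB}{}^{A'}$. A spinor field $\xi^{A'}$ is pure if it is nowhere zero and at every point the kernel of $\xi_a{}^A:T\mathcal M\to\mathcal S^-$ has dimension $m$; this kernel is then a totally null rank-$m$ distribution $\mathcal N_\xi$, the almost null structure of $\xi^{A'}$. Likewise for $\zeta^A$, with $\mathcal N_\zeta=\ker\zeta_a{}^{A'}$. $\mathcal N_\xi$ is totally geodetic if $\nabla_XY\in\Gamma(\mathcal N_\xi)$ for all $X,Y\in\Gamma(\mathcal N_\xi)$; this is equivalent to integrability of $\mathcal N_\xi$, and to $\xi^{A'}$ being geodetic, i.e. $(\xi^{aA}\nabla_a\xi^{bB})\xi_b{}^C=0$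 (equivalently $(\xi^{aA}\nabla_a\xi^{[B'})\xi^{C']}=0$). A conformal Killing spinor is a solution $\xi^{A'}$ of $\nabla_a\xi^{A'}+\frac1{\sqrt2}\gamma_{aB}{}^{A'}\zeta^B=0$ (which forces $\zeta^B=\frac{\sqrt2}n\gamma^a{}_{A'}{}^B\nabla_a\xi^{A'}$). *)

(* Defs.v *)
From HB Require Import structures.
From mathcomp Require Import all_boot all_order all_algebra.
From mathcomp Require Import all_classical all_reals all_analysis.
From mathcomp Require Import complex.

Set Implicit Arguments.
Unset Strict Implicit.
Unset Printing Implicit Defensive.

Import Order.TTheory GRing.Theory Num.Theory.
Import numFieldNormedType.Exports.
Local Open Scope classical_set_scope.
Local Open Scope ring_scope.

(* The field of complex numbers; as a numClosedFieldType rather than as the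
   bare type R[i], because that is what the topological instances are keyed on. *)
Definition Cplx (R : realType) : numClosedFieldType := R[i].

(* Complex manifolds of dimension n. The field [coord i] is a chart with domain
   [dom i], and [pt i] its inverse; the values of [coord i] outside [dom i] and
   of [pt i] outside [coord i @` dom i] are irrelevant. *)
Record complex_manifold (R : realType) (n : nat) := ComplexManifold {
  mpoint :> topologicalType;
  chart : Type;
  dom : chart -> set mpoint;
  coord : chart -> mpoint -> 'rV[Cplx R]_n;
  pt : chart -> 'rV[Cplx R]_n -> mpoint;
  mhausdorff : hausdorff_space mpoint;
  msecond_countable : @second_countable mpoint;
  dom_cover : forall p, exists c, dom c p;
  dom_open : forall c, open (dom c);
  cod_open : forall c, open (coord c @` dom c);
  coordK : forall c p, dom c p -> pt c (coord c p) = p;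
  coord_continuous : forall c p, dom c p -> {for p, continuous (coord c)};
  pt_continuous :
    forall c p, dom c p -> {for coord c p, continuous (pt c)};
  transition_holo : forall c d p, dom c p -> dom d p ->
    differentiable (coord d \o pt c) (coord c p) }.

Arguments dom {R n X} c _ : rename.
Arguments coord {R n X} c _ : rename.
Arguments pt {R n X} c _ : rename.

Section LocalCalculus.
Variables (R : realType) (n : nat) (X : complex_manifold R n).
Variable V : normedModType (Cplx R).

(* Complex (Frechet) differentiability, read in the chart c. *)
Definition holo_at (c : chart X) (f : X -> V) (p : X) : Prop :=
  differentiable (f \o pt c) (coord c p).

Definition pd (c : chart X) (a : 'I_n) (f : X -> V) (p : X) : V :=
  'D_(delta_mx 0 a) (f \o pt c) (coord c p).

End LocalCalculus.

(* Tangent vectors are row vectors of components, so components with respect to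
   the chart c are turned into components with respect to the chart d by right
   multiplication by the Jacobian matrix (d y^b / d x^a)_(a, b). *)
Definition jacobian (R : realType) (n : nat) (X : complex_manifold R n)
    (c d : chart X) (p : X) : 'M[Cplx R]_n :=
  \matrix_(a, b) (pd c a (coord d) p) 0 b.

(* Components of the metric with respect to the coordinates of each chart. *)
Record holo_metric (R : realType) (n : nat) (X : complex_manifold R n) :=
  HoloMetric {
  metric :> chart X -> X -> 'M[Cplx R]_n;
  metric_holo : forall c p, dom c p -> holo_at c (metric c) p;
  metric_sym : forall c p, dom c p -> (metric c p)^T = metric c p;
  metric_nondegenerate : forall c p, dom c p -> metric c p \in unitmx;
  metric_glue : forall c d p, dom c p -> dom d p ->
    metric c p = jacobian c d p *m metric d p *m (jacobian c d p)^T }.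

(* Chiral spinors in dimension 2m are row vectors with 2^(m-1) components. The
   boolean is the chirality: true for S^+ (primed indices), false for S^-.
   [gam b alpha], the Clifford multiplication by the alpha-th vector of an
   orthonormal frame, maps S^b to S^(~~ b) by right multiplication: its row
   index is the lower spinor index, its column index the upper one. *)
Definition sdim (m : nat) : nat := 2 ^ m.-1.

Definition gamma_family (R : realType) (m : nat) : Type :=
  bool -> 'I_m.*2 -> 'M[Cplx R]_(sdim m).

Definition clifford (R : realType) (m : nat) (gam : gamma_family R m) : Prop :=
  forall (b : bool) (a c : 'I_m.*2),
    2%:R^-1 *: (gam b a *m gam (~~ b) c + gam b c *m gam (~~ b) a)
    = - ((a == c)%:R)%:M.

Section Clifford.
Variables (R : realType) (m : nat) (gam : gamma_family R m).

Definition slash (b : bool) (v : 'rV[Cplx R]_m.*2) : 'M[Cplx R]_(sdim m) :=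
  \sum_a v 0 a *: gam b a.

(* Spin(2m, C), acting on S^+ (+) S^-: products of an even number of unit
   vectors of the Clifford algebra. *)
Inductive in_spin : (bool -> 'M[Cplx R]_(sdim m)) -> Prop :=
| in_spin1 : in_spin (fun=> 1%:M)
| in_spinM (v w : 'rV[Cplx R]_m.*2) s :
    v *m v^T = 1%:M -> w *m w^T = 1%:M -> in_spin s ->
    in_spin (fun b => s b *m (slash b v *m slash (~~ b) w)).

(* The matrix psi_alpha^B = psi^(B') gam_(alpha B')^B of psi in S^b. As a map
   from row vectors to S^(~~ b) it is v |-> v . psi. *)
Definition clmx (b : bool) (psi : 'rV[Cplx R]_(sdim m)) :
    'M[Cplx R]_(m.*2, sdim m) :=
  \matrix_(a, B) (psi *m gam b a) 0 B.

Definition null_space (b : bool) (psi : 'rV[Cplx R]_(sdim m)) :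
    'M[Cplx R]_m.*2 :=
  kermx (clmx b psi).

Definition pure (b : bool) (psi : 'rV[Cplx R]_(sdim m)) : Prop :=
  psi != 0 /\ \rank (null_space b psi) = m.

End Clifford.

(* A spin structure is given by orthonormal frames over an open cover, together
   with holomorphic Spin-valued cocycles that lift the SO-valued transition
   functions of the frames. The cover is that of the chart domains, which may
   always be refined. The alpha-th row of [frame c p] holds the coordinate
   components of the alpha-th frame vector; the frames, being related by SO,
   also define the holomorphic volume form. *)
Definition frame_transition (R : realType) (n : nat) (X : complex_manifold R n)
    (frame : chart X -> X -> 'M[Cplx R]_n) (c d : chart X) (p : X) :
    'M[Cplx R]_n :=
  frame c p *m jacobian c d p *m invmx (frame d p).

Record spin_structure (R : realType) (m : nat) (X : complex_manifold R m.*2)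
    (g : holo_metric X) (gam : gamma_family R m) := SpinStructure {
  frame : chart X -> X -> 'M[Cplx R]_m.*2;
  frame_holo : forall c p, dom c p -> holo_at c (frame c) p;
  frame_orthonormal : forall c p, dom c p ->
    frame c p *m g c p *m (frame c p)^T = 1%:M;
  strans : bool -> chart X -> chart X -> X -> 'M[Cplx R]_(sdim m);
  strans_holo : forall b c d p, dom c p -> dom d p ->
    holo_at c (strans b c d) p;
  strans_spin : forall c d p, dom c p -> dom d p ->
    in_spin gam (fun b => strans b c d p);
  strans_lift : forall b c d p, dom c p -> dom d p ->
    forall v : 'rV[Cplx R]_m.*2,
      strans b c d p *m slash gam b (v *m frame_transition frame c d p)
      = slash gam b v *m strans (~~ b) c d p;
  strans_cocycle : forall b c d e p, dom c p -> dom d p -> dom e p ->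
    strans b c d p *m strans b d e p = strans b c e p }.

(* Sections of S^b, by their components in the spin frames. *)
Record spinor_field (R : realType) (m : nat) (X : complex_manifold R m.*2)
    (g : holo_metric X) (gam : gamma_family R m) (S : spin_structure g gam)
    (b : bool) := SpinorField {
  scomp :> chart X -> X -> 'rV[Cplx R]_(sdim m);
  scomp_holo : forall c p, dom c p -> holo_at c (scomp c) p;
  scomp_glue : forall c d p, dom c p -> dom d p ->
    scomp d p = scomp c p *m strans S b c d p }.

(* The holomorphic Levi-Civita connection, that is, the torsion-free metric
   one, by its coefficients both in the coordinate frames
     nabla_a d_c = \sum_b (christoffel c p a) c b d_b
   and in the orthonormal frames
     nabla_a e_al = \sum_be (conn_form c p a) al be e_be.
   Both are uniquely determined by the metric and the frames, which is why no
   gluing condition is needed. *)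
Record levi_civita (R : realType) (m : nat) (X : complex_manifold R m.*2)
    (g : holo_metric X) (gam : gamma_family R m) (S : spin_structure g gam) :=
  LeviCivita {
  christoffel : chart X -> X -> 'I_m.*2 -> 'M[Cplx R]_m.*2;
  conn_form : chart X -> X -> 'I_m.*2 -> 'M[Cplx R]_m.*2;
  christoffel_holo : forall c p a, dom c p ->
    holo_at c (fun q => christoffel c q a) p;
  conn_form_holo : forall c p a, dom c p ->
    holo_at c (fun q => conn_form c q a) p;
  torsion_free : forall c p, dom c p -> forall a b d,
    christoffel c p a b d = christoffel c p b a d;
  metric_compat : forall c p a, dom c p ->
    pd c a (g c) p
    = christoffel c p a *m g c p + g c p *m (christoffel c p a)^T;
  conn_formE : forall c p a, dom c p ->
    pd c a (frame S c) p + frame S c p *m christoffel c p a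
    = conn_form c p a *m frame S c p }.

Section Fields.
Variables (R : realType) (m : nat) (X : complex_manifold R m.*2).
Variables (g : holo_metric X) (gam : gamma_family R m).
Variables (S : spin_structure g gam) (D : levi_civita S).

Local Notation n := m.*2.
Local Notation N := (sdim m).
Local Notation C := (Cplx R).

(* The connection form lifted to spin(2m, C), acting on S^b on the right. The
   sign is fixed by the convention gam_al gam_be + gam_be gam_al = - 2 delta
   and makes Clifford multiplication parallel. *)
Definition spin_conn (b : bool) (c : chart X) (p : X) (a : 'I_n) : 'M[C]_N :=
  - (4%:R^-1 *: \sum_al \sum_be
       conn_form D c p a al be *: (gam b al *m gam (~~ b) be)).

(* Covariant derivatives along the coordinate vector fields: of a vector field
   (given by its components in the orthonormal frame), of a section of S^b, and
   of a section of T (x) S^b (whose row index is the orthonormal frame index; it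
   may be raised and lowered freely). *)
Definition cov_vector_coord c a (Y : X -> 'rV[C]_n) p : 'rV[C]_n :=
  pd c a Y p + Y p *m conn_form D c p a.

Definition cov_spinor_coord b c a (psi : X -> 'rV[C]_N) p : 'rV[C]_N :=
  pd c a psi p + psi p *m spin_conn b c p a.

Definition cov_tspinor_coord b c a (Psi : X -> 'M[C]_(n, N)) p :
    'M[C]_(n, N) :=
  pd c a Psi p + (conn_form D c p a)^T *m Psi p + Psi p *m spin_conn b c p a.

(* The same along the al-th vector of the orthonormal frame. *)
Definition cov_vector c (al : 'I_n) (Y : X -> 'rV[C]_n) p : 'rV[C]_n :=
  \sum_a frame S c p al a *: cov_vector_coord c a Y p.

Definition cov_spinor b c (al : 'I_n) (psi : X -> 'rV[C]_N) p : 'rV[C]_N :=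
  \sum_a frame S c p al a *: cov_spinor_coord b c a psi p.

Definition cov_tspinor b c (al : 'I_n) (Psi : X -> 'M[C]_(n, N)) p :
    'M[C]_(n, N) :=
  \sum_a frame S c p al a *: cov_tspinor_coord b c a Psi p.

Definition conformal_killing (xi : spinor_field S true) : Prop :=
  exists zeta : spinor_field S false,
    forall c p, dom c p -> forall al,
      cov_spinor true c al (xi c) p
      + (sqrtC 2%:R)^-1 *: (zeta c p *m gam false al) = 0.

Definition pure_field (b : bool) (psi : spinor_field S b) : Prop :=
  forall c p, dom c p -> pure gam b (psi c p).

(* zeta^B = (sqrt 2 / n) gam^a_(A')^B nabla_a xi^(A') *)
Definition zeta_of (xi : spinor_field S true) (c : chart X) (p : X) :
    'rV[C]_N :=
  (sqrtC 2%:R / n%:R) *: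
    \sum_al cov_spinor true c al (xi c) p *m gam true al.

(* (psi^(aA) nabla_a psi^(bB)) psi_b^C *)
Definition geod_tensor (b : bool) (psi : chart X -> X -> 'rV[C]_N)
    (c : chart X) (p : X) (A B E : 'I_N) : C :=
  \sum_al \sum_be
    clmx gam b (psi c p) al A
    * cov_tspinor (~~ b) c al (fun q => clmx gam b (psi c q)) p be B
    * clmx gam b (psi c p) be E.

Definition geodetic (xi : spinor_field S true) : Prop :=
  forall c p, dom c p -> forall A B E, geod_tensor true xi c p A B E = 0.

(* Local holomorphic sections Y of the almost null structure over open subsets W
   of chart domains are given by their components in the orthonormal frame. *)
Definition null_section (xi : spinor_field S true) (c : chart X) (W : set X)
    (Y : X -> 'rV[C]_n) : Prop :=
  forall p, W p ->
    holo_at c Y p /\ (Y p <= null_space gam true (xi c p))%MS.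

Definition totally_geodetic (xi : spinor_field S true) : Prop :=
  forall (c : chart X) (W : set X), open W -> W `<=` dom c ->
  forall Y Z : X -> 'rV[C]_n, null_section xi c W Y -> null_section xi c W Z ->
  forall p, W p ->
    ((\sum_al Y p 0 al *: cov_vector c al Z p)%R
       <= null_space gam true (xi c p))%MS.

(* zeta^(aA') zeta_a^(B') = 0 and xi^(aB) zeta_a^(A') = - 2 zeta^B xi^(A') *)
Definition star (xi zeta : chart X -> X -> 'rV[C]_N) : Prop :=
  forall c p, dom c p ->
    (forall A B : 'I_N,
       \sum_al clmx gam false (zeta c p) al A * clmx gam false (zeta c p) al B
       = 0)
    /\ (forall A B : 'I_N,
       \sum_al clmx gam true (xi c p) al B * clmx gam false (zeta c p) al A
       = - 2%:R * zeta c p 0 B * xi c p 0 A).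

Definition pure_and_incident (xi zeta : chart X -> X -> 'rV[C]_N) : Prop :=
  forall c p, dom c p -> zeta c p != 0 ->
    let K := (null_space gam false (zeta c p)
                :&: null_space gam true (xi c p))%MS in
    [/\ pure gam false (zeta c p),
        \rank K = m.-1 &
        forall u v : 'rV[C]_n, (u <= K)%MS -> (v <= K)%MS -> u *m v^T = 0].

Definition sym12 (N' : nat) (T : 'I_N' -> 'I_N' -> 'I_N' -> C) A B E : C :=
  2%:R^-1 * (T A B E + T B A E).

Definition skew3 (N' : nat) (T : 'I_N' -> 'I_N' -> 'I_N' -> C) A B E : C :=
  6%:R^-1 * (T A B E + T B E A + T E A B - T B A E - T A E B - T E B A).

End Fields.

(* Main.v *)
From HB Require Import structures.
Require Import Defs.
From mathcomp Require Import all_boot all_order all_algebra.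
From mathcomp Require Import all_classical all_reals all_analysis.
From mathcomp Require Import complex ring lra zify.

Set Implicit Arguments.
Unset Strict Implicit.
Unset Printing Implicit Defensive.

Import Order.TTheory GRing.Theory Num.Theory.
Import numFieldNormedType.Exports.
Local Open Scope classical_set_scope.
Local Open Scope ring_scope.

(** A pure spinor [xi] is one whose columns [n_A := xi^{aA}] are null and mutually
orthogonal; they span [N_xi], and the only spinors killed by [N_xi] are the
multiples of [xi]: adding the [m] null vectors of a basis of [N_xi] one after
the other, each halves the dimension of the space of spinors killed so far,
which starts at [2^m].

If [nabla_a xi = - gamma_a zeta / sqrt 2], the geodesy tensor is
[- (n_E n_A zeta)^B / sqrt 2]. It is skew in [A], [E], and differentiating
[xi^{aA} xi_a^B = 0] makes it skew in [A], [B] too. It vanishes iff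
[N_xi . zeta] lies in the line of [xi], iff [zeta = w . xi] for some vector [w],
and this is what both [star] and the incidence condition amount to.

For the last claim, the integrability condition
[R_{abcd} gamma^c gamma^d xi ~ gamma_b nabla_a zeta - gamma_a nabla_b zeta],
contracted with [gamma^b], yields [nabla_a zeta = P_{ab} gamma^b xi] with [P] a
combination of the metric and the Ricci tensor; under [star] the tensor of [zeta]
is then [2 (xi^E Q^{AB} - xi^B Q^{AE})] with [Q = Phi^T P Phi] symmetric,
[Phi] being [zeta_a^A]. Holomorphy is only used in the form of complex
differentiability: [xi] and the frames have differentiable first derivatives,
and then their second derivatives are symmetric. *)

(** * Symmetry of second derivatives *)

Section Schwarz.
Variable R : realType.
Local Notation C := (Cplx R).

Definition toC (x : R) : C := real_complex R x.

Lemma toCD x y : toC (x + y) = toC x + toC y. Proof. exact: rmorphD. Qed.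
Lemma toCM x y : toC (x * y) = toC x * toC y. Proof. exact: rmorphM. Qed.
Lemma toC_gt0 x : (0 < toC x) = (0 < x). Proof. by rewrite -(ltcR 0 x). Qed.
Lemma toC_le x y : (toC x <= toC y) = (x <= y). Proof. exact: lecR. Qed.
Lemma toC_lt x y : (toC x < toC y) = (x < y). Proof. exact: ltcR. Qed.
Lemma norm_toC x : `|toC x| = toC `|x|.
Proof. by rewrite [LHS]normc_def /= expr0n addr0 sqrtr_sqr. Qed.
Definition re (z : C) : R := complex.Re z.
Lemma reD (x y : C) : re (x + y) = re x + re y. Proof. exact: raddfD. Qed.
Lemma reB (x y : C) : re (x - y) = re x - re y. Proof. exact: raddfB. Qed.
Lemma reN (x : C) : re (- x) = - re x. Proof. exact: raddfN. Qed.
Lemma reM x (y : C) : re (toC x * y) = x * re y.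
Proof. by case: y => a b; rewrite /re /= mul0r subr0. Qed.
Lemma re_norm (y : C) : toC `|re y| <= `|y|. Proof. exact: normc_ge_Re. Qed.
Lemma toC_re (y : C) : 0 <= y -> y = toC (re y).
Proof. by case: y => a b; rewrite lecE /= => /andP[/eqP -> _]. Qed.

(** The complex difference quotient is restricted to real increments; [re] is additive, commutes
    with real scalars and does not increase norms, so it passes to the limit. *)
Lemma is_derive_re (V : normedModType C) (F : V -> C) (x u : V) (s : R) :
  derivable F (x + toC s *: u) u ->
  is_derive s 1 (fun t => re (F (x + toC t *: u))) (re ('D_u F (x + toC s *: u))).
Proof.
set y := x + _ => Fd.
have Fc : h^-1 *: (F (h *: u + y) - F y) @[h --> 0^'] --> 'D_u F y by exact: Fd.
suff H : h^-1 *: (re (F (x + toC (h *: (1 : R) + s) *: u)) - re (F y)) @[h --> (0:R)^']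
   --> re ('D_u F y).
  apply: DeriveDef; last exact: cvg_lim H.
  by apply/cvg_ex; exists (re ('D_u F y)).
apply/cvgrPdist_le => /= e e0.
move/cvgrPdist_le : Fc => /(_ (toC e)); rewrite toC_gt0 => /(_ e0) [/= d d0].
(* A positive element of [C] is real, so the radius [d] may be replaced by its real part. *)
have d1 := d0; move: d0; rewrite (toC_re (ltW d1)) toC_gt0 => d0 Hd.
exists (re d) => // h /= hd h0.
rewrite -toC_le; apply: le_trans (Hd (toC h) _ _) => /=.
- rewrite [leRHS](_ : _
  = `|'D_u F y - (toC h)^-1 *: (F (x + toC (h *: (1 : R) + s) *: u) - F y)|).
    apply: le_trans (re_norm _); rewrite reB.
    by rewrite -[(toC h)^-1]fmorphV reM reB.
  by rewrite /y scaler1 toCD scalerDl addrCA.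
- by move: hd; rewrite !sub0r !normrN norm_toC toC_lt.
- by move: h0; apply: contra_neq => /complexI.
Qed.

Lemma differentiable_estimate (V W : normedModType C) (G : V -> W) (x : V) (e : R) :
  differentiable G x -> 0 < e ->
  exists2 d : R, 0 < d & forall z, `|z| < toC d ->
    `|G (x + z) - G x - 'd G x z| <= toC e * `|z|.
Proof.
move=> /diff_locally /eqaddoP Gx e0.
have := Gx (toC e); rewrite toC_gt0 => /(_ e0) /nbhs_ballP [/= d d0 Hd].
have d1 := d0; move: d0; rewrite (toC_re (ltW d1)) toC_gt0 => d0.
exists (re d) => // z zd.
have /= := Hd z; rewrite opprD addrA [x + z]addrC; apply.
by rewrite -ball_normE /= sub0r normrN (toC_re (ltW d1)).
Qed.

Lemma nbhs_toC_ball (V : normedModType C) (P : set V) (x : V) : nbhs x P ->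
  exists2 d : R, 0 < d & forall z, `|z| < toC d -> P (x + z).
Proof.
move=> /nbhs_ballP [/= d d0 Hd].
have d1 := d0; move: d0; rewrite (toC_re (ltW d1)) toC_gt0 => d0.
exists (re d) => // z zd; apply: Hd; rewrite -ball_normE /= opprD addNKr normrN.
by rewrite (toC_re (ltW d1)).
Qed.

(** Symmetric in [u] and [v]; the real part of its quotient by [h ^+ 2] approximates that of the
    mixed derivative in either order, which forces the two orders to agree. *)
Definition second_difference (V : normedModType C) (F : V -> C) (x u v : V) (h : R) : C :=
  F (x + toC h *: u + toC h *: v) - F (x + toC h *: u) - F (x + toC h *: v) + F x.

Lemma second_differenceC (V : normedModType C) (F : V -> C) (x u v : V) (h : R) :
  second_difference F x u v h = second_difference F x v u h.
Proof.
rewrite /second_difference [x + toC h *: v + _]addrAC; congr (_ + F x).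
exact: (@addrAC C).
Qed.

(* The increments are real, so that the real mean value theorem applies to
   [t |-> Re (F (x + h v + t u) - F (x + t u))]; its derivative is estimated by
   differentiability of [G] at [x] alone. *)
Lemma second_difference_estimate (V : normedModType C) (F G : V -> C) (x u v : V)
    (e : R) :
  (\forall y \near x, differentiable F y /\ 'D_u F y = G y) ->
  differentiable G x -> 0 < e ->
  exists2 d : R, 0 < d & forall h, 0 < h < d ->
    `|re (second_difference F x u v h) - h ^+ 2 * re ('D_v G x)|
      <= e * h ^+ 2.
Proof.
move=> Fx Gx e0.
(* [h * M] bounds every increment [s u + t v] with [s], [t] between 0 and [h]; the summand 1 keeps
   [M] positive when [u] and [v] vanish. *)
pose M := re `|u| + re `|v| + 1.
have nu : `|u| = toC (re `|u|) by exact: toC_re.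
have nv : `|v| = toC (re `|v|) by exact: toC_re.
have u0 : 0 <= re `|u| by rewrite -toC_le -nu; exact: (normr_ge0 u).
have v0 : 0 <= re `|v| by rewrite -toC_le -nv; exact: (normr_ge0 v).
have M0 : 0 < M by rewrite ltr_wpDl // addr_ge0.
have [d1 d10 Hd1] := nbhs_toC_ball Fx.
(* With this tolerance each of the two uses of differentiability of [G] below costs [e / 2 * h]. *)
have [d2 d20 Hd2] := differentiable_estimate Gx (divr_gt0 e0 (mulr_gt0 (ltr0n _ 2) M0)).
exists (Num.min d1 d2 / M); first by rewrite divr_gt0 // lt_min d10.
move=> h /andP[h0 hd].
have zn s t : 0 <= s <= h -> 0 <= t <= h ->
    `|toC s *: u + toC t *: v| <= toC (h * M).
  move=> /andP[s0 sh] /andP[t0 th].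
  apply: le_trans (ler_normD _ _) _;
    rewrite !normrZ !norm_toC nu nv -!toCM -toCD toC_le.
  rewrite !ger0_norm // /M !mulrDr mulr1 -[leLHS]addr0 lerD ?(ltW h0)
    // lerD // ler_wpM2r //.
have hM : h * M < Num.min d1 d2 by rewrite -ltr_pdivlMr.
have zn1 s t : 0 <= s <= h -> 0 <= t <= h ->
    let y := x + (toC s *: u + toC t *: v) in differentiable F y /\ 'D_u F y = G y.
  move=> hs ht; apply: Hd1; apply: le_lt_trans (zn _ _ hs ht) _.
  by rewrite toC_lt (lt_le_trans hM) // ge_min lexx.
pose phi (t : R) := re (F (x + toC h *: v + toC t *: u)) - re (F (x + toC t *: u)).
pose dphi (t : R) := re (G (x + toC h *: v + toC t *: u)) - re (G (x + toC t *: u)).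
have hh : 0 <= h <= h by rewrite (ltW h0) lexx.
have h00 : (0:R) <= 0 <= h by rewrite lexx (ltW h0).
have phiD t : 0 <= t <= h -> is_derive t 1 phi (dphi t).
  move=> ht; apply: is_deriveB.
    have [] := zn1 t h ht hh; rewrite [toC t *: u + _]addrC addrA => dF <-.
    exact/is_derive_re/diff_derivable.
  have [] := zn1 t 0 ht h00; rewrite scale0r addr0 => dF <-.
  exact/is_derive_re/diff_derivable.
have [||s] := @MVT R phi dphi 0 h h0.
- by move=> t; rewrite in_itv /= => /andP[t0 th]; apply: phiD; rewrite !ltW.
- apply: derivable_within_continuous => t; rewrite in_itv /= => th.
  by have [] := phiD t th.
rewrite in_itv /= subr0 => /andP[s0 sh] phiE.
have hs : 0 <= s <= h by rewrite !ltW.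
have -> : re (second_difference F x u v h) = phi h - phi 0.
  rewrite /phi /second_difference [toC 0]rmorph0 scale0r !addr0 !(reD, reN).
  rewrite [x + _ + _]addrAC; lra.
rewrite phiE.
set L := 'd G x.
have est t : 0 <= t <= h ->
    `|G (x + (toC s *: u + toC t *: v)) - G x - L (toC s *: u + toC t *: v)|
      <= toC (e / 2 * h).
  move=> ht; apply: le_trans (Hd2 _ _) _.
    by rewrite (le_lt_trans (zn _ _ hs ht)) // toC_lt (lt_le_trans hM)
      // ge_min lexx orbT.
  have -> : e / 2 * h = (e / (2 * M)) * (h * M) by field; rewrite gt_eqF.
  rewrite [leRHS]toCM ler_wpM2l // ?zn // -[0]/(toC 0)
    toC_le ltW // divr_gt0 // mulr_gt0 //.
have E1 := est h hh; have E2 := est 0 h00.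
rewrite [toC 0]rmorph0 scale0r addr0 in E2.
have -> : 'D_v G x = L v by exact: deriveE.
(* The two values of [L] differ by [h L v] and [G x] cancels, so only the two remainders controlled
   by [est] are left. *)
have -> : dphi s * h - h ^+ 2 * re (L v)
    = h * re ((G (x + (toC s *: u + toC h *: v)) - G x - L (toC s *: u + toC h *: v))
              - (G (x + toC s *: u) - G x - L (toC s *: u))).
  rewrite [L (_ + _)]linearD ![L (_ *: _)]linearZ /dphi !(reD, reN) !reM
    [x + toC h *: v + _]addrAC addrA; lra.
rewrite normrM gtr0_norm // expr2 mulrA [e * h]mulrC -mulrA ler_pM2l //.
rewrite -toC_le (le_trans (re_norm _)) // (le_trans (ler_normB _ _)) //.
by rewrite (splitr e) mulrDl [leRHS]toCD lerD.
Qed.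

Lemma close_of_scaled_close (a b r k e : R) : 0 < k ->
  `|r - k * a| <= e / 2 * k -> `|r - k * b| <= e / 2 * k -> `|a - b| <= e.
Proof.
move=> k0 ra rb; rewrite -(ler_pM2r k0) -[X in _ * X <= _](gtr0_norm k0) -normrM.
have -> : (a - b) * k = (r - k * b) - (r - k * a) by ring.
by rewrite (le_trans (ler_normB _ _)) // (splitr e) mulrDl addrC lerD.
Qed.

(** One and the same second difference is estimated with [u] taken first and with [v] taken
    first. *)
Lemma re_derive_comm (V : normedModType C) (F Gu Gv : V -> C) (x u v : V) :
  (\forall y \near x, [/\ differentiable F y, 'D_u F y = Gu y & 'D_v F y = Gv y]) ->
  differentiable Gu x -> differentiable Gv x ->
  re ('D_v Gu x) = re ('D_u Gv x).
Proof.
move=> Fx dGu dGv; apply/eqP; rewrite -subr_eq0 -normr_le0; apply/ler_addgt0Pl => e e0.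
rewrite addr0.
have e20 : 0 < e / 2 by rewrite divr_gt0.
have Fu : \forall y \near x, differentiable F y /\ 'D_u F y = Gu y.
  by apply: filterS Fx => y [].
have Fv : \forall y \near x, differentiable F y /\ 'D_v F y = Gv y.
  by apply: filterS Fx => y [].
have [d d0 Hd] := second_difference_estimate v Fu dGu e20.
have [d' d'0 Hd'] := second_difference_estimate u Fv dGv e20.
pose h := Num.min d d' / 2.
have h0 : 0 < h by rewrite divr_gt0 // lt_min d0.
have hm : h < Num.min d d' by rewrite ltr_pdivrMr // ltr_pMr ?ltr1n // lt_min d0.
have := Hd h; have := Hd' h; rewrite h0 (lt_le_trans hm) ?ge_min ?lexx ?orbT //=.
rewrite (lt_le_trans hm) ?ge_min ?lexx //= => /(_ isT) E1 /(_ isT) E2.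
have h2 : 0 < h ^+ 2 by rewrite exprn_gt0.
rewrite second_differenceC in E1; exact: close_of_scaled_close h2 E2 E1.
Qed.

Lemma derive_comm (V : normedModType C) (F Gu Gv : V -> C) (x u v : V) :
  (\forall y \near x, [/\ differentiable F y, 'D_u F y = Gu y & 'D_v F y = Gv y]) ->
  differentiable Gu x -> differentiable Gv x ->
  'D_v Gu x = 'D_u Gv x.
Proof.
move=> Fx dGu dGv; have reE := re_derive_comm Fx dGu dGv.
pose i : C := complex.Complex 0 1.
(* The imaginary part of F is minus the real part of i F. *)
have := @re_derive_comm V (i *: F) (i *: Gu) (i *: Gv) x u v.
have iFx : \forall y \near x, [/\ differentiable (i *: F) y, 'D_u (i *: F) y
  = (i *: Gu) y & 'D_v (i *: F) y = (i *: Gv) y].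
  near=> y.
  have [dF Fu Fv] : [/\ differentiable F y, 'D_u F y = Gu y & 'D_v F y
    = Gv y] by near: y.
  split; first exact: differentiableZ.
    by rewrite deriveZ ?Fu //; exact: diff_derivable.
  by rewrite deriveZ ?Fv //; exact: diff_derivable.
move=> /(_ iFx (differentiableZ _ dGu) (differentiableZ _ dGv)).
rewrite !deriveZ; try exact: diff_derivable.
move: reE; case: ('D_v Gu x) => a b; case: ('D_u Gv x) => c d /=.
by rewrite /re /= => ->; rewrite !mul0r !sub0r !mul1r => /oppr_inj ->.
Unshelve. all: by end_near. Qed.
End Schwarz.

(** * Matrix-valued functions on charts *)

Section MatrixCalculus.
Variables (R : realType).
Local Notation C := (Cplx R).

Lemma mx_linear_sumE (V : normedModType C) k l (L : {linear 'M[C]_(k, l) -> V}) :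
  (L : _ -> _) = \sum_i \sum_j (fun M : 'M[C]_(k, l) => M i j *: L (delta_mx i j)).
Proof.
apply/funext => M; rewrite [M in LHS]matrix_sum_delta linear_sum fct_sumE.
apply: eq_bigr => i _; rewrite linear_sum fct_sumE.
by apply: eq_bigr => j _; rewrite linearZ.
Qed.

(** A linear map on matrices is a finite sum of coordinate functions times constant vectors, hence
    differentiable and so continuous. *)
Lemma mx_linear_continuous (V : normedModType C) k l (L : {linear 'M[C]_(k, l) -> V}) :
  continuous L.
Proof.
move=> M; apply: differentiable_continuous; rewrite mx_linear_sumE.
apply: differentiable_sum => i; apply: differentiable_sum => j.
apply: differentiableZl; exact: differentiable_coord.
Qed.

Section At.
Variables (V : normedModType C) (x v : V).

Lemma differentiable_mx_linear k l (W : normedModType C)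
    (L : {linear 'M[C]_(k, l) -> W})
    (f : V -> 'M[C]_(k, l)) :
  differentiable f x -> differentiable (L \o f) x.
Proof.
move=> df; apply: differentiable_comp => //; apply: linear_differentiable.
exact: mx_linear_continuous.
Qed.

Lemma derive_mx_linear k l (W : normedModType C) (L : {linear 'M[C]_(k, l) -> W})
    (f : V -> 'M[C]_(k, l)) :
  differentiable f x -> 'D_v (L \o f) x = L ('D_v f x).
Proof.
move=> df; have Lc := @mx_linear_continuous _ _ _ L.
rewrite !deriveE //; last exact: differentiable_mx_linear.
by rewrite diff_comp //= ?diff_lin //; exact: linear_differentiable.
Qed.

Definition entry k l i j (M : 'M[C]_(k, l)) : C := M i j.
Fact entry_is_linear k l i j : linear (@entry k l i j).
Proof. by move=> a M N; rewrite /entry !mxE. Qed.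
HB.instance Definition _ k l i j :=
  GRing.isLinear.Build C 'M[C]_(k, l) C _ (@entry k l i j) (@entry_is_linear k l i j).

Lemma derive_entry k l (f : V -> 'M[C]_(k, l)) i j :
  differentiable f x -> ('D_v f x) i j = 'D_v (fun y => f y i j) x.
Proof. by move=> df; rewrite -[LHS]/(entry i j _) -derive_mx_linear. Qed.

Lemma differentiable_entry k l (f : V -> 'M[C]_(k, l)) i j :
  differentiable f x -> differentiable (fun y => f y i j) x.
Proof. exact: (@differentiable_mx_linear _ _ _ (@entry k l i j)). Qed.

Lemma differentiable_mx k l (f : V -> 'M[C]_(k, l)) :
  (forall i j, differentiable (fun y => f y i j) x) -> differentiable f x.
Proof.
move=> df; have -> : f = \sum_i \sum_j (fun y => f y i j *: delta_mx i j).
  apply/funext => y; rewrite [LHS]matrix_sum_delta fct_sumE.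
  by apply: eq_bigr => i _; rewrite fct_sumE.
apply: differentiable_sum => i; apply: differentiable_sum => j.
exact: differentiableZl.
Qed.

Lemma mulmx_entriesE k l r (f : V -> 'M[C]_(k, l)) (g : V -> 'M[C]_(l, r)) i j :
  (fun y => (f y *m g y) i j) = \sum_s (fun y => f y i s) * (fun y => g y s j).
Proof. by apply/funext => y; rewrite mxE fct_sumE. Qed.

Lemma differentiable_mulmx k l r (f : V -> 'M[C]_(k, l)) (g : V -> 'M[C]_(l, r)) :
  differentiable f x -> differentiable g x -> differentiable (fun y => f y *m g y) x.
Proof.
move=> df dg; apply: differentiable_mx => i j; rewrite mulmx_entriesE.
apply: differentiable_sum => s.
exact: differentiableM (differentiable_entry i s df) (differentiable_entry s j dg).
Qed.

Lemma derive_mulmx k l r (f : V -> 'M[C]_(k, l)) (g : V -> 'M[C]_(l, r)) :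
  differentiable f x -> differentiable g x ->
  'D_v (fun y => f y *m g y) x = 'D_v f x *m g x + f x *m 'D_v g x.
Proof.
move=> df dg; apply/matrixP => i j; rewrite derive_entry;
  last exact: differentiable_mulmx.
have de s : derivable (fun y => f y i s) x v /\ derivable (fun y => g y s j) x v.
  by split; apply: diff_derivable; exact: differentiable_entry.
rewrite (mulmx_entriesE f g i j) derive_sum; last first.
  by move=> s; have [df' dg'] := de s; exact: derivableM df' dg'.
rewrite !mxE -big_split; apply: eq_bigr => s _ /=; have [df' dg'] := de s.
rewrite (deriveM df' dg') (derive_entry i s df) (derive_entry s j dg) addrC.
by congr (_ + _); exact: mulrC.
Qed.

End At.
End MatrixCalculus.

Section ChartCalculus.
Variables (R : realType) (n : nat) (X : complex_manifold R n).
Variables (c : chart X) (U : set X).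
Hypotheses (Uopen : open U) (Udom : U `<=` dom c).
Local Notation C := (Cplx R).

(** Identities are given at points of [U], derivatives are taken in coordinates. Openness of the
    chart image and continuity of [pt c] allow statements near [coord c p] to be checked on [U]. *)
Lemma chart_near p : U p ->
  \forall y \near Defs.coord c p, exists2 q, U q & y = Defs.coord c q.
Proof.
move=> Up; have dp := Udom Up.
have n1 : \forall y \near Defs.coord c p, (Defs.coord c @` dom c) y.
  by apply: open_nbhs_nbhs; split; [exact: cod_open | exists p].
have n2 : \forall y \near Defs.coord c p, U (pt c y).
  apply: (pt_continuous dp); rewrite coordK //.
  by apply: open_nbhs_nbhs; split.
near=> y.
have [q dq qy] : (Defs.coord c @` dom c) y by near: y.
by exists q => //; rewrite -(coordK dq) qy; near: y.
Unshelve. all: by end_near. Qed.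

Lemma eq_pd (V : normedModType C) (f h : X -> V) p a :
  U p -> (forall q, U q -> f q = h q) -> pd c a f p = pd c a h p.
Proof.
move=> Up fh; apply: near_eq_derive.
apply: filterS (chart_near Up) => y [q Uq ->] /=.
by rewrite coordK ?fh //; exact: Udom.
Qed.

Lemma holo_mx_linear k l k' l' (L : {linear 'M[C]_(k, l) -> 'M[C]_(k', l')})
    (f : X -> 'M[C]_(k, l)) p :
  holo_at c f p -> holo_at c (fun q => L (f q)) p.
Proof. exact: differentiable_mx_linear. Qed.

Lemma pd_mx_linear k l k' l' (L : {linear 'M[C]_(k, l) -> 'M[C]_(k', l')})
    (f : X -> 'M[C]_(k, l)) p a :
  holo_at c f p -> pd c a (fun q => L (f q)) p = L (pd c a f p).
Proof. exact: derive_mx_linear. Qed.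

Lemma holo_mulmx k l r (f : X -> 'M[C]_(k, l)) (h : X -> 'M[C]_(l, r)) p :
  holo_at c f p -> holo_at c h p -> holo_at c (fun q => f q *m h q) p.
Proof. exact: differentiable_mulmx. Qed.

Lemma pd_mulmx k l r (f : X -> 'M[C]_(k, l)) (h : X -> 'M[C]_(l, r)) p a :
  U p -> holo_at c f p -> holo_at c h p ->
  pd c a (fun q => f q *m h q) p = pd c a f p *m h p + f p *m pd c a h p.
Proof.
move=> Up df dh.
transitivity (pd c a f p *m h (pt c (Defs.coord c p)) + f (pt c (Defs.coord c p))
  *m pd c a h p).
  exact: (derive_mulmx (delta_mx 0 a) df dh).
by rewrite (coordK (Udom Up)).
Qed.

Lemma pd_cst (V : normedModType C) (v : V) p a : pd c a (fun=> v) p = 0.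
Proof. exact: derive_cst. Qed.

Lemma holoB (V : normedModType C) (f h : X -> V) p :
  holo_at c f p -> holo_at c h p -> holo_at c (fun q => f q - h q) p.
Proof. exact: differentiableB. Qed.

Lemma pdB (V : normedModType C) (f h : X -> V) p a :
  holo_at c f p -> holo_at c h p ->
  pd c a (fun q => f q - h q) p = pd c a f p - pd c a h p.
Proof. by move=> df dh; apply: deriveB; exact: diff_derivable. Qed.

Lemma pd_comm k l (f fa fb : X -> 'M[C]_(k, l)) p a b :
  U p -> (forall q, U q -> holo_at c f q) ->
  (forall q, U q -> pd c a f q = fa q) -> (forall q, U q -> pd c b f q = fb q) ->
  holo_at c fa p -> holo_at c fb p ->
  pd c b fa p = pd c a fb p.
Proof.
move=> Up df dfa dfb ha hb; apply/matrixP => i j.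
transitivity ('D_(delta_mx 0 b) (fun y => fa (pt c y) i j) (Defs.coord c p)).
  exact: (derive_entry (delta_mx 0 b) i j ha).
transitivity ('D_(delta_mx 0 a) (fun y => fb (pt c y) i j) (Defs.coord c p));
  last first.
  by apply/esym; exact: (derive_entry (delta_mx 0 a) i j hb).
apply: (@derive_comm _ _ (fun y => f (pt c y) i j)).
- apply: filterS (chart_near Up) => _ [q Uq ->]; rewrite (coordK (Udom Uq)); split.
  + exact: (differentiable_entry i j (df _ Uq)).
  + rewrite -dfa //; apply/esym; exact: (derive_entry (delta_mx 0 a) i j (df _ Uq)).
  + rewrite -dfb //; apply/esym; exact: (derive_entry (delta_mx 0 b) i j (df _ Uq)).
- exact: (differentiable_entry i j ha).
- exact: (differentiable_entry i j hb).
Qed.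

End ChartCalculus.

(** * Pure spinors *)

(** [K = kermx P] is isotropic. If its rank is [m], it equals its own orthogonal complement; the
    columns of [P] are orthogonal to [K], hence lie in [K] and are killed by [P]. Conversely, if
    they lie in [K], then [2m - rank K <= rank K], while isotropy gives the opposite inequality. *)
Lemma lagrangian_ker (F : fieldType) m N (P : 'M[F]_(m.*2, N)) :
  kermx P *m (kermx P)^T = 0 -> \rank (kermx P) = m <-> P^T *m P = 0.
Proof.
set K := kermx P => KK; have KP : K *m P = 0 by exact: mulmx_ker.
have rK : \rank K = (m.*2 - \rank P)%N by rewrite mxrank_ker.
have rP : (\rank P <= m.*2)%N by exact: rank_leq_row.
have KK' : (K <= kermx K^T)%MS by exact/sub_kermxP.
split=> [rKm|PP]; last first.
  have PK : (P^T <= K)%MS by exact/sub_kermxP.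
  have := mxrankS PK; have := mxrankS KK'; rewrite mxrank_ker !mxrank_tr; lia.
have /andP[_ K'K] : (K == kermx K^T)%MS.
  by rewrite -(geq_leqif (mxrank_leqif_eq KK')) mxrank_ker mxrank_tr rKm -addnn addnK.
by apply/sub_kermxP/(submx_trans _ K'K)/sub_kermxP; rewrite -trmx_mul KP trmx0.
Qed.

Section PureSpinors.
Variables (R : realType) (m : nat) (gam : gamma_family R m).
Hypothesis hgam : clifford gam.
Local Notation C := (Cplx R).
Local Notation n := m.*2.
Local Notation N := (sdim m).
Implicit Types (b : bool) (psi : 'rV[C]_N) (u v w : 'rV[C]_n).

Lemma gamM b a c :
  gam b a *m gam (~~ b) c = - (2%:R * (a == c)%:R)%:M - gam b c *m gam (~~ b) a.
Proof.
have /(congr1 ( *:%R (2%:R : C))) := hgam b a c.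
rewrite scalerA divff ?pnatr_eq0 // scale1r scalerN scale_scalar_mx => <-.
by rewrite addrK.
Qed.

Lemma slash_is_linear b : linear (slash gam b).
Proof.
move=> k u v; rewrite /slash scaler_sumr -big_split; apply: eq_bigr => a _ /=.
by rewrite !mxE scalerDl scalerA.
Qed.
HB.instance Definition _ b :=
  GRing.isLinear.Build C 'rV[C]_n 'M[C]_N _ (slash gam b) (slash_is_linear b).

Lemma slash_delta b a : slash gam b (delta_mx 0 a) = gam b a.
Proof.
rewrite /slash (bigD1 a) //= mxE !eqxx scale1r big1 ?addr0 // => c ca.
by rewrite mxE (negPf ca) andbF scale0r.
Qed.

Lemma dotC u v : (u *m v^T) 0 0 = (v *m u^T) 0 0.
Proof. by rewrite !mxE; apply: eq_bigr => i _; rewrite !mxE mulrC. Qed.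

Lemma slashM b u v :
  slash gam b u *m slash gam (~~ b) v
  = - (2%:R * (u *m v^T) 0 0)%:M - slash gam b v *m slash gam (~~ b) u.
Proof.
rewrite /slash !mulmx_suml.
under eq_bigr do rewrite mulmx_sumr.
under [X in _ = _ - X]eq_bigr do rewrite mulmx_sumr.
rewrite [X in _ - X]exchange_big /=.
have -> : (2%:R * (u *m v^T) 0 0)%:M =
   \sum_a \sum_c (u 0 a * v 0 c) *: (2%:R * (a == c)%:R)%:M :> 'M[C]_N.
  rewrite mxE mulr_sumr [LHS](raddf_sum (@scalar_mx C N)); apply: eq_bigr => a _.
  rewrite (bigD1 a) //= eqxx big1 => [|c ca].
    by rewrite addr0 mxE scale_scalar_mx mulr1 mulrC.
  by rewrite eq_sym (negPf ca) mulr0 raddf0 scaler0.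
rewrite -!sumrN -big_split; apply: eq_bigr => a _ /=.
rewrite -!sumrN -big_split; apply: eq_bigr => c _ /=.
rewrite -!scalemxAl -!scalemxAr !scalerA gamM scalerBr scalerN.
by rewrite [v 0 c * _]mulrC.
Qed.

Lemma clmxE b psi a B : clmx gam b psi a B = (psi *m gam b a) 0 B.
Proof. by rewrite mxE. Qed.

Lemma mul_clmx v b psi : v *m clmx gam b psi = psi *m slash gam b v.
Proof.
rewrite /slash mulmx_sumr; apply/rowP => B; rewrite mxE summxE.
by apply: eq_bigr => a _; rewrite -scalemxAr [RHS]mxE clmxE.
Qed.

Lemma clmx_is_linear b : linear (clmx gam b).
Proof.
move=> k u v; apply/matrixP => a B; rewrite clmxE [RHS]mxE [X in _ = X + _]mxE !clmxE.
by rewrite mulmxDl -scalemxAl [LHS]mxE [X in X + _ = _]mxE.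
Qed.
HB.instance Definition _ b :=
  GRing.isLinear.Build C 'rV[C]_N 'M[C]_(n, N) _ (clmx gam b) (clmx_is_linear b).

Lemma sub_null_space k (A : 'M[C]_(k, n)) b psi :
  (A <= null_space gam b psi)%MS = (A *m clmx gam b psi == 0).
Proof. by rewrite sub_kermx. Qed.

Lemma null_spaceP v b psi :
  reflect (psi *m slash gam b v = 0) (v <= null_space gam b psi)%MS.
Proof. by rewrite sub_null_space mul_clmx; exact: eqP. Qed.

(** Two vectors that kill [psi] have an anticommutator that kills it too; this is the scalar
    [-2 u.v], and [psi] is not zero. *)
Lemma null_space_null b psi k l (A : 'M[C]_(k, n)) (B : 'M[C]_(l, n)) : psi != 0 ->
  (A <= null_space gam b psi)%MS -> (B <= null_space gam b psi)%MS -> A *m B^T = 0.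
Proof.
move=> psi0 AN BN; apply/matrixP => i j.
have /null_spaceP ui := submx_trans (row_sub i A) AN.
have /null_spaceP vj := submx_trans (row_sub j B) BN.
have := congr1 (mulmx psi) (slashM b (row i A) (row j B)).
rewrite mulmxBr !mulmxA ui vj !mul0mx subr0 mulmxN mul_mx_scalar => /esym/eqP.
rewrite oppr_eq0 scaler_eq0 (negPf psi0) orbF mulf_eq0 pnatr_eq0 /=.
move=> /eqP AB; rewrite [RHS]mxE -AB !mxE.
by apply: eq_bigr => s _; rewrite !mxE.
Qed.

Lemma pure_clmx b psi : psi != 0 ->
  pure gam b psi <-> (clmx gam b psi)^T *m clmx gam b psi = 0.
Proof.
move=> psi0; have KK := null_space_null psi0 (submx_refl _) (submx_refl _).
have H := lagrangian_ker (KK b); split=> [[_ /H]|/H] //.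
Qed.

Section Vacuum.
Variables r d : nat -> 'rV[C]_n.
Hypothesis rr : forall i j, (i < m)%N -> (j < m)%N -> (r i *m (r j)^T) 0 0 = 0.
Hypothesis rd : forall i j, (i < m)%N -> (j < m)%N -> (r i *m (d j)^T) 0 0
  = (i == j)%:R.

(* Clifford multiplication on S^+ (+) S^-. *)
Definition total_slash v : 'M[C]_(N + N) :=
  block_mx 0 (slash gam true v) (slash gam false v) 0.

Lemma total_slashM u v :
  total_slash u *m total_slash v
  = - (2%:R * (u *m v^T) 0 0)%:M - total_slash v *m total_slash u.
Proof.
rewrite /total_slash !mulmx_block !mulmx0 !mul0mx !addr0 !add0r.
rewrite (slashM true) (slashM false)
  /= scalar_mx_block opp_block_mx opp_block_mx add_block_mx.
by rewrite !oppr0 !addr0.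
Qed.

(** As in a Fock space: the spinors annihilated by the first [k] null vectors. Both chiralities are
    kept together because Clifford multiplication exchanges them. *)
Fixpoint vacuum k : 'M[C]_(N + N) :=
  if k is k'.+1 then (vacuum k' :&: kermx (total_slash (r k')))%MS else 1%:M.

Lemma sub_vacuum l (A : 'M[C]_(l, N + N)) k :
  reflect (forall i, (i < k)%N -> A *m total_slash (r i) = 0) (A <= vacuum k)%MS.
Proof.
elim: k => [|k IHk] /=; first by rewrite submx1; left.
rewrite sub_capmx; apply: (iffP andP) => [[/IHk Ak /sub_kermxP Ar] i|Ar].
  by rewrite ltnS leq_eqVlt => /orP[/eqP ->|/Ak].
by split; [apply/IHk => i ik; apply: Ar; exact: ltnW | apply/sub_kermxP/Ar].
Qed.

(** On [vacuum k] the image of [r k] equals its kernel. The image lies in the kernel since [r k]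
    squares to zero and anticommutes with the earlier [r i]. Conversely, an [x] of the kernel is
    [-1/2] times [r k] applied to [d k . x], as [r k] and [d k] have product 1, and [d k . x] stays
    in [vacuum k] because [d k] is orthogonal to the earlier [r i]. *)
Lemma vacuum_step k : (k < m)%N ->
  (vacuum k *m total_slash (r k) :=: vacuum k.+1)%MS.
Proof.
move=> km; apply/eqmxP/andP; split.
  apply/sub_vacuum => i; rewrite ltnS => ik; have im := leq_ltn_trans ik km.
  rewrite -mulmxA total_slashM rr // mulr0 raddf0 oppr0 sub0r mulmxN mulmxA.
  move: ik; rewrite leq_eqVlt => /orP[/eqP ->|ik]; last first.
    by have /sub_vacuum -> := submx_refl (vacuum k); rewrite // mul0mx oppr0.
  have := total_slashM (r k) (r k); rewrite rr // mulr0 raddf0 oppr0 sub0r.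
  move=> /eqP; rewrite -addr_eq0 -mulr2n -scaler_nat scaler_eq0 pnatr_eq0 /= => /eqP r2.
  by rewrite -mulmxA r2 mulmx0 oppr0.
set W := vacuum k.+1.
have /sub_vacuum Wr := submx_refl W.
have Wd : (W *m total_slash (d k) <= vacuum k)%MS.
  apply/sub_vacuum => i ik; rewrite -mulmxA total_slashM mulmxBr mulmxA.
  have im := ltn_trans ik km.
  by rewrite dotC rd // ltn_eqF // mulr0 raddf0 oppr0 mulmx0 Wr ?mul0mx ?subr0 // ltnW.
have -> : W = (- (2%:R : C)^-1) *: (W *m total_slash (d k) *m total_slash (r k)).
  rewrite -mulmxA total_slashM mulmxBr [W *m (_ *m _)]mulmxA Wr // mul0mx subr0.
  rewrite dotC rd // eqxx mulr1 mulmxN mul_mx_scalar scalerN scaleNr opprK.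
  by rewrite scalerA mulVf ?pnatr_eq0 // scale1r.
exact/scalemx_sub/submxMr.
Qed.

(** Image and kernel of [r k] on [vacuum k] both being [vacuum k.+1], rank-nullity halves the rank
    at each step. *)
Lemma rank_vacuum k : (k <= m)%N -> (\rank (vacuum k) * 2 ^ k)%N = (N + N)%N.
Proof.
elim: k => [|k IHk] km; first by rewrite /= mxrank1 muln1.
apply: etrans (IHk (ltnW km)); rewrite expnS mulnA; congr (_ * _)%N;
  rewrite muln2 -addnn.
rewrite -[RHS](mxrank_mul_ker _ (total_slash (r k))).
by rewrite (vacuum_step km).
Qed.

Lemma rank_vacuum_total : (0 < m)%N -> \rank (vacuum m) = 1%N.
Proof.
move=> m0; have N2 : (N + N = 1 * 2 ^ m)%N by rewrite addnn -mul2n -expnS prednK //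
  mul1n.
by have /eqP := etrans (rank_vacuum (leqnn m)) N2;
  rewrite eqn_pmul2r ?expn_gt0 // => /eqP.
Qed.

End Vacuum.

Lemma null_basis b psi : pure gam b psi ->
  exists r d : nat -> 'rV[C]_n,
    [/\ forall i j, (i < m)%N -> (j < m)%N -> (r i *m (r j)^T) 0 0 = 0,
        forall i j, (i < m)%N -> (j < m)%N -> (r i *m (d j)^T) 0 0 = (i == j)%:R,
        forall i, (r i <= null_space gam b psi)%MS &
        forall v, (v <= null_space gam b psi)%MS -> exists x : nat -> C,
          v = \sum_(i < m) x i *: r i].
Proof.
move=> [psi0 rK]; set K := null_space gam b psi.
have [B Bfree BK] : exists2 B : 'M[C]_(m, n), row_free B & (B :=: K)%MS.
  move: (row_base K) (row_base_free K) (eq_row_base K); rewrite rK => B ? ?.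
  by exists B.
have ordP i : (i < m)%N -> exists i' : 'I_m, i = i' by move=> im; exists (Ordinal im).
(* The default 0 beyond [m] keeps every [r i] inside the null space. *)
pose r i := if insub i is Some i' then row i' B else 0.
(* As [B] is row free, [pinvmx B] is a right inverse of it, and its columns are dual to the rows of
   [B]. *)
pose d i := if insub i is Some i' then row i' (pinvmx B)^T else 0.
have rE (i : 'I_m) : r i = row i B by rewrite /r valK.
have dE (i : 'I_m) : d i = row i (pinvmx B)^T by rewrite /d valK.
have Bn : (B <= null_space gam b psi)%MS by rewrite BK.
have BB := null_space_null psi0 Bn Bn.
have rowM k (A : 'M[C]_(m, k)) (D : 'M[C]_(m, k)) i j :
   (row i A *m (row j D)^T) 0 0 = (A *m D^T) i j.
  by rewrite !mxE; apply: eq_bigr => s _; rewrite !mxE.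
exists r, d; split.
- by move=> _ _ /ordP[i ->] /ordP[j ->]; rewrite !rE rowM BB mxE.
- by move=> _ _ /ordP[i ->] /ordP[j ->]; rewrite rE dE rowM trmxK mulmxVp // mxE.
- by move=> i; rewrite /r; case: insub => [i'|];
  rewrite ?sub0mx // (submx_trans (row_sub _ _)) // BK.
- move=> v; rewrite -BK => /submxP[D ->].
  exists (fun i => if insub i is Some i' then D 0 i' else 0).
  by rewrite mulmx_sum_row; apply: eq_bigr => i _; rewrite rE valK.
Qed.

Hypothesis m0 : (0 < m)%N.

Section KilledByNull.
Variable xi : 'rV[C]_N.
Hypothesis xi_pure : pure gam true xi.

(** [(chi, phi)] lies in [vacuum r m], which has rank one and contains [(xi, 0)]. In particular no
    non-zero spinor of the other chirality is killed by all of N_xi. *)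
Lemma vacuum_line (chi phi : 'rV[C]_N) :
  (forall v, (v <= null_space gam true xi)%MS ->
     chi *m slash gam true v = 0 /\ phi *m slash gam false v = 0) ->
  exists2 a, chi = a *: xi & phi = 0.
Proof.
move=> H; have [r [d [rr rd rK _]]] := null_basis xi_pure.
have /eqP rV := rank_vacuum_total rr rd m0.
have mulS (x y : 'rV[C]_N) v : row_mx x y *m total_slash v
  = row_mx (y *m slash gam false v) (x *m slash gam true v).
  by rewrite mul_row_block !mulmx0 addr0 add0r.
have xiV : (row_mx xi 0 <= vacuum r m)%MS.
  by apply/sub_vacuum => i _; rewrite mulS (null_spaceP _ _ _ (rK i)) mul0mx row_mx0.
have Vxi : (vacuum r m <= row_mx xi 0)%MS.
  rewrite -(geq_leqif (mxrank_leqif_sup xiV)) (eqP rV) lt0n mxrank_eq0.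
  by rewrite -row_mx0; apply: contra_neq xi_pure.1 => /eq_row_mx[].
have : (row_mx chi phi <= vacuum r m)%MS.
  by apply/sub_vacuum => i _; rewrite mulS; have [-> ->] := H _ (rK i); rewrite row_mx0.
move=> /submx_trans /(_ Vxi) /sub_rVP[a];
  rewrite scale_row_mx scaler0 => /eq_row_mx[-> ->].
by exists a.
Qed.

End KilledByNull.
End PureSpinors.

(** * Pointwise equivalents of the relations between xi and zeta *)

Section Incidence.
Variables (R : realType) (m : nat) (gam : gamma_family R m).
Hypothesis hgam : clifford gam.
Local Notation C := (Cplx R).
Local Notation n := m.*2.
Local Notation N := (sdim m).
Implicit Types u v w : 'rV[C]_n.

Lemma slash_sum b k (u : 'I_k -> 'rV[C]_n) :
  slash gam b (\sum_i u i) = \sum_i slash gam b (u i).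
Proof. exact: linear_sum. Qed.

Lemma slashZ b a u : slash gam b (a *: u) = a *: slash gam b u.
Proof. exact: linearZ. Qed.

Lemma slash_row b b' (psi phi : 'rV[C]_N) A :
  phi *m slash gam b (row A (clmx gam b' psi)^T)
  = row A ((clmx gam b' psi)^T *m clmx gam b phi).
Proof. by rewrite -mul_clmx row_mul. Qed.

(** Purity puts the columns of [clmx gam b psi] inside the kernel, and both spaces have rank [m]. *)
Lemma pure_null_space b (psi : 'rV[C]_N) : pure gam b psi ->
  (null_space gam b psi :=: (clmx gam b psi)^T)%MS.
Proof.
move=> psi_pure; have [psi0 rK] := psi_pure.
have PK : ((clmx gam b psi)^T <= null_space gam b psi)%MS.
  by apply/sub_kermxP; exact/(pure_clmx hgam b psi0).
apply/eqmx_sym/eqmxP; rewrite -(geq_leqif (mxrank_leqif_eq PK)) rK mxrank_tr.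
have : \rank (null_space gam b psi) = (m.*2 - \rank (clmx gam b psi))%N.
  exact: mxrank_ker.
rewrite rK; have := rank_leq_row (clmx gam b psi); lia.
Qed.

Lemma slash_null b (psi phi : 'rV[C]_N) u v : psi != 0 ->
  (u <= null_space gam b psi)%MS -> (v <= null_space gam b psi)%MS ->
  forall b', phi *m slash gam b' u *m slash gam (~~ b') v
   = - (phi *m slash gam b' v *m slash gam (~~ b') u).
Proof.
move=> psi0 uN vN b'; rewrite -mulmxA slashM // (null_space_null hgam psi0 uN vN).
by rewrite mxE mulr0 raddf0 oppr0 sub0r mulmxN mulmxA.
Qed.

Hypothesis m0 : (0 < m)%N.
Variable xi : 'rV[C]_N.
Hypothesis xi_pure : pure gam true xi.
Variable zeta : 'rV[C]_N.
Let K := null_space gam true xi.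
Let Psi := clmx gam true xi.
Let Phi := clmx gam false zeta.

Lemma line_factor :
  (forall v, (v <= K)%MS -> exists a, zeta *m slash gam false v = a *: xi) ->
  exists w, zeta = xi *m slash gam true w.
Proof.
move=> H; have [r [d [rr rd rK spanK]]] := null_basis hgam xi_pure.
have /choice[l lE] : forall i, exists a, zeta *m slash gam false (r i) = a *: xi.
  by move=> i; exact: H.
(* Since [r j] kills [xi], acting with [r j] on [w . xi] gives [-2 (w . r j) xi], which has to equal
   [l j *: xi]; the dual vectors [d] solve for [w]. *)
have [w wr] : exists w, forall j : 'I_m, (w *m (r j)^T) 0 0 = - (2%:R)^-1 * l j.
  exists (\sum_(i < m) (- (2%:R)^-1 * l i) *: d i) => j.
  rewrite mulmx_suml summxE (bigD1 j) //= big1 => [|i ij].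
    by rewrite -scalemxAl mxE dotC rd // eqxx mulr1 addr0.
  move: ij; rewrite -val_eqE eq_sym => /negPf ij.
  by rewrite -scalemxAl mxE dotC rd // ij mulr0.
(* zeta - w . xi is killed by N_xi and has the chirality opposite to xi. *)
exists w; have [|_ _ /eqP] := @vacuum_line _ _ _ hgam m0 _ xi_pure 0 (zeta - xi *m
  slash gam true w); last first.
  by rewrite subr_eq0 => /eqP.
move=> v /spanK[x ->]; rewrite mul0mx; split => //.
rewrite slash_sum mulmx_sumr big1 // => j _; rewrite slashZ -scalemxAr mulmxBl lE.
have rj : xi *m slash gam true (r j) = 0 by exact/null_spaceP.
rewrite -mulmxA (slashM hgam true) mulmxBr mulmxA rj mul0mx subr0.
rewrite wr mulNr mulrN mulVKf ?pnatr_eq0 // (raddfN (@scalar_mx C N)) opprK /=.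
rewrite mul_mx_scalar subrr.
by rewrite scaler0.
Qed.

(** The two equations of [star] at one point, in matrix form. *)
Definition star_at := Phi^T *m Phi = 0 /\ Psi^T *m Phi = - 2%:R *: (zeta^T *m xi).

(** Moving [w] past the free vector index gives [Phi = -2 w^T xi - Psi *m slash w]. The rest follows
    from [Psi^T Psi = 0], [w Psi = zeta] and [w . w . xi = -(w.w) xi]. *)
Lemma factor_star w : zeta = xi *m slash gam true w -> star_at.
Proof.
move=> zE; have PP := (pure_clmx hgam true xi_pure.1).1 xi_pure.
have wPsi : w *m Psi = zeta by rewrite mul_clmx.
have PhiE : Phi = - 2%:R *: (w^T *m xi) - Psi *m slash gam false w.
  apply/row_matrixP => a; rewrite !rowE mulmxBr; move: (delta_mx 0 a) => u.
  rewrite [LHS]mul_clmx [in LHS]zE -mulmxA (slashM hgam true) mulmxBr mulmxA.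
  congr (_ - _); last by rewrite mulmxA mul_clmx.
  rewrite mulmxN mul_mx_scalar -scalemxAr mulmxA [u *m w^T]mx11_scalar mul_scalar_mx.
  by rewrite dotC scalerA mulNr scaleNr.
split; last first.
  apply/row_matrixP => B; rewrite -slash_row zE -mulmxA (slashM hgam true)
    mulmxBr mulmxA.
  have xB : xi *m slash gam true (row B Psi^T) = 0.
    by apply/null_spaceP; apply: submx_trans (row_sub _ _) _; rewrite pure_null_space.
  rewrite xB mul0mx subr0 -zE mulmxN mul_mx_scalar -scaleNr -mulNr -scalerA.
  have -> : (w *m (row B Psi^T)^T) 0 0 = zeta 0 B.
    by rewrite -wPsi tr_row trmxK colE mulmxA -colE [LHS]mxE.
  by apply/rowP => A; rewrite !mxE big_ord1 !mxE.
have zz : zeta *m slash gam false w = - (w *m w^T) 0 0 *: xi.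
  have /= /eqP := slashM hgam true w w; rewrite eq_sym subr_eq -mulr2n => /eqP ww.
  rewrite zE -mulmxA; apply: (@scalerI _ _ (2%:R : C)); first by rewrite pnatr_eq0.
  by rewrite scalemxAr scaler_nat -ww mulmxN mul_mx_scalar scalerA mulrN scaleNr.
have PhiT : Phi^T = - 2%:R *: (xi^T *m w) - (slash gam false w)^T *m Psi^T.
  by rewrite PhiE [LHS]linearB /= [X in X - _]linearZ /= !trmx_mul trmxK.
(* Of the four products one contains [Psi^T Psi] and vanishes; the others are 4, 2 and 2 times
   [q xi^T xi], the last two with a minus sign. *)
rewrite PhiT PhiE mulmxBl !mulmxBr.
set q := w *m w^T in zz; set G := slash gam false w in zz *.
have -> : (G^T *m Psi^T) *m (Psi *m G)
  = 0 by rewrite mulmxA -[X in X *m G]mulmxA PP mulmx0 mul0mx.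
rewrite subr0.
have -> : (- 2%:R *: (xi^T *m w)) *m (- 2%:R *: (w^T *m xi))
  = (4%:R * q 0 0) *: (xi^T *m xi).
  rewrite -scalemxAl -scalemxAr scalerA mulmxA -[xi^T *m _ *m _]mulmxA -/q.
  rewrite [in LHS](mx11_scalar q) mul_mx_scalar -scalemxAl scalerA; congr (_ *: _).
  by ring.
have -> : (- 2%:R *: (xi^T *m w)) *m (Psi *m G) = (2%:R * q 0 0) *: (xi^T *m xi).
  rewrite -scalemxAl mulmxA -[xi^T *m w *m Psi]mulmxA wPsi -mulmxA zz -scalemxAr
    scalerA.
  by rewrite mulrNN.
have -> : (G^T *m Psi^T) *m (- 2%:R *: (w^T *m xi)) = (2%:R * q 0 0) *: (xi^T *m xi).
  rewrite -scalemxAr mulmxA -[G^T *m _ *m _]mulmxA -trmx_mul wPsi -trmx_mul zz.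
  by rewrite linearZ /= -scalemxAl scalerA mulrNN.
rewrite -!scalerBl (_ : _ - _ - _ = 0) ?scale0r //; ring.
Qed.

(** The second equation says that N_xi . zeta lies in the line of [xi], which N_xi kills. *)
Lemma star_at_slash : star_at -> forall u v, (u <= K)%MS -> (v <= K)%MS ->
  zeta *m slash gam false u *m slash gam true v = 0.
Proof.
move=> [_ PPhi] u v; rewrite [(u <= _)%MS]pure_null_space // =>
  /submxP[D ->] /null_spaceP xv.
rewrite -[zeta *m _]mul_clmx -/Phi -[D *m _ *m _]mulmxA PPhi -scalemxAr mulmxA.
by rewrite [D *m _]mx11_scalar mul_scalar_mx -!scalemxAl xv !scaler0.
Qed.

(** The columns of [Psi] span N_xi, so for [v] in N_xi the spinor [v . zeta] is killed by N_xi and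
    is a multiple of [xi]; then [zeta] factors through [xi]. *)
Lemma null_null_star :
  (forall A E, zeta *m slash gam false (row A Psi^T) *m slash gam true (row E Psi^T)
    = 0) ->
  star_at.
Proof.
move=> H; have [|w] := line_factor; last exact: factor_star.
move=> v vK; have [|a -> _] := @vacuum_line _ _ _ hgam m0 _ xi_pure (zeta *m slash gam
  false v) 0; last by exists a.
move=> u uK; split; last by rewrite mul0mx.
move: uK vK; rewrite ![(_ <= K)%MS]pure_null_space // => /submxP[D ->] /submxP[D' ->].
rewrite [D *m _]mulmx_sum_row [D' *m _]mulmx_sum_row !slash_sum mulmx_sumr big1 // => j
  _.
rewrite [zeta *m _]mulmx_sumr mulmx_suml big1 // => i _.
by rewrite !slashZ -!scalemxAr -scalemxAl H !scaler0.
Qed.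

Definition incident_at := zeta != 0 ->
  let L := (null_space gam false zeta :&: K)%MS in
  [/\ pure gam false zeta, \rank L = m.-1 &
      forall u v, (u <= L)%MS -> (v <= L)%MS -> u *m v^T = 0].

(** Rank-nullity for the action of N_xi on [zeta]: an intersection of dimension [m.-1] amounts to
    N_xi . zeta being a line. *)
Lemma rank_null_space_Phi : (\rank (K *m Phi) + \rank (null_space gam false zeta :&:
  K)%MS)%N = m.
Proof. by rewrite capmxC mxrank_mul_ker xi_pure.2. Qed.

(** [Psi^T Phi] is a multiple of [zeta^T xi], so N_xi . zeta is at most a line; it is not zero
    because neither [zeta] nor [xi] is. *)
Lemma star_incident : star_at -> incident_at.
Proof.
move=> [PhiPhi PPhi] z0 L; split; first exact/(pure_clmx hgam false z0).
- have := rank_null_space_Phi; rewrite -/L.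
  have [D KD] : exists D, K = D *m Psi^T by apply/submxP; rewrite pure_null_space.
  have [D' PD] : exists D', Psi^T = D' *m K by apply/submxP; rewrite pure_null_space.
  have : (\rank (K *m Phi) <= 1)%N.
    rewrite KD -mulmxA PPhi -scalemxAr mulmxA; apply: leq_trans (rank_leq_row xi).
    exact/mxrankS/scalemx_sub/submxMl.
  have : (0 < \rank (K *m Phi))%N.
    rewrite lt0n mxrank_eq0; apply/eqP => KPhi.
    have /eqP := PPhi; rewrite PD -mulmxA KPhi mulmx0 eq_sym scaler_eq0 oppr_eq0
      pnatr_eq0 /=.
    move=> /eqP zx; have /rV0Pn[A zA] := z0.
    case/negP: xi_pure.1; apply/eqP/rowP => B; rewrite mxE.
    have /eqP := congr1 (fun M : 'M[C]_N => M A B) zx.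
    by rewrite !mxE big_ord1 !mxE mulf_eq0 (negPf zA) /= => /eqP.
  by move: (\rank (K *m Phi)) (\rank L) => r s; lia.
- move=> u v uL vL; apply: (null_space_null hgam xi_pure.1).
    exact: submx_trans uL (capmxSr _ _).
  exact: submx_trans vL (capmxSr _ _).
Qed.

Lemma incident_star : incident_at -> star_at.
Proof.
have [z0 _|z0 /(_ z0)[z_pure rL _]] := eqVneq zeta 0.
  by rewrite /star_at /Phi z0 linear0 !mulmx0 trmx0 mul0mx scaler0.
have r1 : \rank (K *m Phi) = 1%N by have := rank_null_space_Phi; rewrite rL; lia.
have [phi phiE] : exists phi : 'rV[C]_N, (K *m Phi :=: phi)%MS.
  move: (row_base (K *m Phi)) (eq_row_base (K *m Phi)); rewrite r1 => phi phiE.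
  by exists phi; exact/eqmx_sym.
have : (phi <= K *m Phi)%MS by rewrite phiE.
move=> /submxP[x]; rewrite mulmxA => xE.
have v0K : (x *m K <= K)%MS by exact: submxMl.
have lin v : (v <= K)%MS -> exists a, zeta *m slash gam false v = a *: phi.
  move=> vK; apply/sub_rVP; rewrite -phiE -mul_clmx -/Phi; exact: submxMr.
have e0 : zeta *m slash gam false (x *m K) = phi by rewrite -mul_clmx xE.
have v00 : phi *m slash gam true (x *m K) = 0.
  have := slash_null zeta xi_pure.1 v0K v0K false; rewrite e0 /=.
  by move=> /eqP; rewrite -addr_eq0 -mulr2n -scaler_nat scaler_eq0 pnatr_eq0 => /eqP.
(* N_xi . zeta is the line of phi = v0 . zeta; as null vectors anticommute,
   u . phi = - v0 . (u . zeta) is a multiple of v0 . phi = v0 . v0 . zeta = 0. *)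
have killed u : (u <= K)%MS -> phi *m slash gam true u = 0.
  move=> uK; rewrite -e0 (slash_null zeta xi_pure.1 v0K uK false) /=.
  by have [a ->] := lin u uK; rewrite -scalemxAl v00 scaler0 oppr0.
have [|a phia _] := @vacuum_line _ _ _ hgam m0 _ xi_pure phi 0.
  by move=> u uK; rewrite killed // mul0mx.
have [|w] := line_factor; last exact: factor_star.
by move=> v /lin[a' ->]; rewrite phia scalerA; exists (a' * a).
Qed.

End Incidence.

(** * The Ricci contraction of the integrability condition *)

Section RiemannAlgebra.
Variables (F : numFieldType) (I : finType) (r : I -> I -> I -> I -> F).
Hypothesis rN12 : forall a b c d, r b a c d = - r a b c d.
Hypothesis rN34 : forall a b c d, r a b d c = - r a b c d.
Hypothesis bianchi : forall a b c d, r a b c d + r b c a d + r c a b d = 0.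

(** Four cyclic identities, starting at [a], [b], [c] and [d], are combined with signs [+ + - -];
    the unwanted terms cancel by the two skew symmetries. *)
Lemma riemann_pair a b c d : r a b c d = r c d a b.
Proof.
have B2 : - r b c a d - r c d a b + r b d a c = 0.
  rewrite -[RHS](bianchi b c d a) (rN34 b c a d) (rN34 c d a b).
  by rewrite (rN12 b d c a) (rN34 b d a c) opprK.
have B3 : r c d a b - r d a b c + r c a b d = 0.
  rewrite -[RHS](bianchi c d a b) (rN34 d a b c).
  by rewrite (rN12 c a d b) (rN34 c a b d) opprK.
have B4 : r d a b c - r a b c d + r b d a c = 0.
  by rewrite -[RHS](bianchi d a b c) (rN34 a b c d).
apply/eqP; rewrite -subr_eq0; apply/eqP.
have -> : r a b c d - r c d a b = 2%:R^-1 *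
   ((r a b c d + r b c a d + r c a b d) + (- r b c a d - r c d a b + r b d a c)
    - (r c d a b - r d a b c + r c a b d) - (r d a b c - r a b c d + r b d a c))
      by field.
by rewrite bianchi B2 B3 B4 addr0 !subr0 mulr0.
Qed.

Lemma riemann_cycle a b c d : r a b c d + r a c d b + r a d b c = 0.
Proof.
rewrite (riemann_pair a b) (riemann_pair a c) (riemann_pair a d).
rewrite (rN34 c d b a) (rN34 d b c a) (rN34 b c d a) -!opprD.
by rewrite [X in - X]addrC addrA bianchi oppr0.
Qed.

(** Indices refer to an orthonormal frame, so the contraction is a plain sum. The sign is that of
    contracting the second index with the third. *)
Definition ricci a d := \sum_b r a b b d.

(** In the cyclic identity for [a b d] with last index [b], the term [r d a b b] vanishes by
    skewness. *)
Lemma ricci_sym a d : ricci a d = ricci d a.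
Proof.
apply: eq_bigr => b _; have := bianchi a b d b.
rewrite (rN34 a b b d) (rN12 d b a b) (rN34 d b b a) opprK.
have /eqP := rN34 d a b b; rewrite -addr_eq0 -mulr2n mulrn_eq0 /= => /eqP ->.
by rewrite addr0 addrC => /eqP; rewrite subr_eq0 => /eqP ->.
Qed.

End RiemannAlgebra.

Lemma sum3_rot (V : nmodType) (I : finType) (f : I -> I -> I -> V) :
  \sum_b \sum_c \sum_d f b c d = \sum_b \sum_c \sum_d f c d b.
Proof.
rewrite [RHS]exchange_big /=; apply: eq_bigr => b _.
by rewrite exchange_big.
Qed.

Section DiracTrick.
Variables (R : realType) (m : nat) (gam : gamma_family R m).
Hypotheses (hgam : clifford gam) (m2 : (2 < m)%N).
Local Notation C := (Cplx R).
Local Notation n := m.*2.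
Local Notation N := (sdim m).
Variable r : 'I_n -> 'I_n -> 'I_n -> 'I_n -> C.
Hypothesis rN12 : forall a b c d, r b a c d = - r a b c d.
Hypothesis rN34 : forall a b c d, r a b d c = - r a b c d.
Hypothesis bianchi : forall a b c d, r a b c d + r b c a d + r c a b d = 0.
Variables (psi : 'rV[C]_N) (Z : 'I_n -> 'rV[C]_N) (k : C).
Hypothesis k0 : k != 0.
Hypothesis curv : forall a b,
  \sum_c \sum_d r a b c d *: (psi *m gam true c *m gam false d)
  = k *: (Z a *m gam false b - Z b *m gam false a).

Let e a := psi *m gam true a.
Let S b c d := psi *m gam true b *m gam false c *m gam true d.

Lemma gamMr b (phi : 'rV[C]_N) x y :
  phi *m gam b x *m gam (~~ b) y
  = - (2%:R * (x == y)%:R) *: phi - phi *m gam b y *m gam (~~ b) x.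
Proof. by rewrite -!mulmxA gamM // mulmxBr mulmxN mul_mx_scalar scaleNr. Qed.

Lemma gam_sqr b (phi : 'rV[C]_N) x : phi *m gam b x *m gam (~~ b) x = - phi.
Proof.
have /eqP := gamMr b phi x x; rewrite eqxx mulr1 eq_sym subr_eq -mulr2n => /eqP H.
apply: (@scalerI _ _ (2%:R : C)); first by rewrite pnatr_eq0.
by rewrite scaler_nat -H scaleNr scalerN.
Qed.

Lemma gam3_swap12 b c d : S b c d = - (2%:R * (b == c)%:R) *: e d - S c b d.
Proof. by rewrite /S (gamMr true) mulmxBl -scalemxAl. Qed.

Lemma gam3_swap23 b c d : S b c d = - (2%:R * (c == d)%:R) *: e b - S b d c.
Proof. by rewrite /S (gamMr false). Qed.

Let rho a := \sum_d ricci r a d *: e d.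

Lemma sum_riemann_ricci a : \sum_b \sum_c \sum_d (r a b c d * (b == c)%:R) *:
  e d = rho a.
Proof.
transitivity (\sum_b \sum_d r a b b d *: e d).
  apply: eq_bigr => b _; rewrite (bigD1 b) //= [X in _ + X]big1 => [|c cb].
    by rewrite addr0; apply: eq_bigr => d _; rewrite eqxx mulr1.
  by rewrite big1 // => d _; rewrite eq_sym (negPf cb) mulr0 scale0r.
by rewrite exchange_big; apply: eq_bigr => d _; rewrite /ricci scaler_suml.
Qed.

(** Splits off the Ricci term that the delta of a Clifford relation produces under contraction with
    [r]. *)
Lemma sum_riemann_diag (f g : 'I_n -> 'I_n -> 'I_n -> 'rV[C]_N) a (x : C) :
  (forall b c d, f b c d = x *: ((b == c)%:R *: e d) + g b c d) ->
  \sum_b \sum_c \sum_d r a b c d *: f b c d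
  = x *: rho a + \sum_b \sum_c \sum_d r a b c d *: g b c d.
Proof.
move=> fg; rewrite -sum_riemann_ricci !scaler_sumr -big_split; apply: eq_bigr => b _ /=.
rewrite !scaler_sumr -big_split; apply: eq_bigr => c _ /=.
rewrite !scaler_sumr -big_split; apply: eq_bigr => d _ /=.
by rewrite fg scalerDr !scalerA mulrCA mulrA.
Qed.

Lemma sum_riemann_swap (f : 'I_n -> 'I_n -> 'I_n -> 'rV[C]_N) a :
  \sum_b \sum_c \sum_d r a b c d *: f b d c
  = - \sum_b \sum_c \sum_d r a b c d *: f b c d.
Proof.
rewrite -sumrN; apply: eq_bigr => b _; rewrite exchange_big -sumrN.
apply: eq_bigr => c _; rewrite -sumrN; apply: eq_bigr => d _.
by rewrite rN34 scaleNr.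
Qed.

Let X a := \sum_b \sum_c \sum_d r a b c d *: S c d b.

Lemma dirac_ricci a : X a = 2%:R *: rho a.
Proof.
pose X1 := \sum_b \sum_c \sum_d r a b c d *: S b c d.
pose X2 := \sum_b \sum_c \sum_d r a b c d *: S d b c.
(* X1 and X2 are X up to Clifford relations; E0 is the cyclic identity. *)
have E0 : X a + X1 + X2 = 0.
  rewrite /X /X1 /X2 [X in _ + X + _]sum3_rot [X in _ + _ + X]sum3_rot [X in _ + _ +
    X]sum3_rot.
  rewrite -!big_split big1 // => b _; rewrite -!big_split big1 // => c _ /=.
  rewrite -!big_split big1 // => d _ /=.
  by rewrite -!scalerDl riemann_cycle // scale0r.
have E2 : X2 = - 2%:R *: rho a + X a.
  rewrite /X2 (@sum_riemann_diag _ (fun b c d => - S d c b) _ (- 2%:R)) => [|b c d];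
    last first.
    by rewrite gam3_swap23 scalerA mulNr.
  congr (_ + _); transitivity (- \sum_b \sum_c \sum_d r a b c d *: S d c b).
    rewrite -sumrN; apply: eq_bigr => b _; rewrite -sumrN; apply: eq_bigr => c _.
    by rewrite -sumrN; apply: eq_bigr => d _; rewrite scalerN.
  by rewrite (sum_riemann_swap (fun b c d => S c d b)) opprK.
have E1 : X1 = - 4%:R *: rho a + X a.
  rewrite /X1 (@sum_riemann_diag _ (fun b c d =>
    (2%:R * (b == d)%:R) *: e c + S c d b) _ (- 2%:R)) => [|b c d]; last first.
    by rewrite gam3_swap12 (gam3_swap23 c b d)
      !scaleNr opprB opprK scalerA [S c d b + _]addrC.
  rewrite (_ : - 4%:R = - 2%:R - 2%:R); last by ring.
  rewrite scalerDl -addrA; congr (_ + _).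
  transitivity ((\sum_b \sum_c \sum_d r a b c d *: ((2%:R * (b == d)%:R) *:
    e c)) + X a).
    rewrite -big_split; apply: eq_bigr => b _; rewrite -big_split;
      apply: eq_bigr => c _.
    by rewrite -big_split; apply: eq_bigr => d _; rewrite scalerDr.
  congr (_ + _); rewrite (sum_riemann_swap (fun b c d => (2%:R * (b == c)%:R) *: e d)).
  rewrite scaleNr -sum_riemann_ricci scaler_sumr; congr (- _); apply: eq_bigr => b _;
    rewrite scaler_sumr.
  apply: eq_bigr => c _; rewrite scaler_sumr; apply: eq_bigr => d _.
  by rewrite !scalerA mulrCA.
have : 3%:R *: (X a - 2%:R *: rho a) = 0.
  rewrite -[RHS]E0 E1 E2; move: (X a) (rho a) => x y.
  rewrite [RHS](AC (1*2*2) ((1*3*5)*(2*4))) /= -scalerDl -opprD -natrD scaleNr.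
  have -> : x + x + x = 3%:R *: x by rewrite scaler_nat !mulrSr mulr0n add0r.
  by rewrite scalerBr scalerA -natrM.
by move=> /eqP; rewrite scaler_eq0 pnatr_eq0 /= subr_eq0 => /eqP.
Qed.

(** [curv] times the [b]-th gamma matrix, summed over [b]. On the right the squares of the gammas
    give [- n Z a]; in the other term the interchange of gammas [a] and [b] gives [2 Z a] and the
    Dirac contraction [D]. *)
Lemma dirac_contraction a (D := \sum_b Z b *m gam false b) :
  2%:R *: rho a = k *: ((2%:R - n%:R) *: Z a + D *m gam true a).
Proof.
rewrite -dirac_ricci.
transitivity (\sum_b (k *: (Z a *m gam false b - Z b *m gam false a)) *m gam true b).
  apply: eq_bigr => b _; rewrite -curv mulmx_suml; apply: eq_bigr => c _.
  by rewrite mulmx_suml; apply: eq_bigr => d _; rewrite -scalemxAl.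
have -> : D *m gam true a = \sum_b Z b *m gam false b *m gam true a by rewrite
  mulmx_suml.
have E b : (k *: (Z a *m gam false b - Z b *m gam false a)) *m gam true b
   = k *: (- Z a + (2%:R * (b == a)%:R) *: Z b + Z b *m gam false b *m gam true a).
  rewrite -scalemxAl mulmxBl (gam_sqr false) (gamMr false) opprB scaleNr opprK.
  by rewrite -addrA [X in - _ + X]addrC [a == b]eq_sym.
under eq_bigr do rewrite E.
rewrite -scaler_sumr; congr (_ *: _); rewrite big_split; congr (_ + _).
rewrite big_split /= sumr_const card_ord scalerBl addrC scaler_nat mulNrn;
  congr (_ - _).
  rewrite (bigD1 a) //= eqxx mulr1 big1 ?addr0 ?scaler_nat // => b ba.
  by rewrite (negPf ba) mulr0 scale0r.
by rewrite scaler_nat.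
Qed.

(** By symmetry of [ricci] only the anticommutator of the two gammas survives; the sum is doubled in
    order to exhibit it. *)
Lemma ricci_trace : \sum_a rho a *m gam false a = - (\sum_a ricci r a a) *: psi.
Proof.
apply: (@scalerI _ _ (2%:R : C)); first by rewrite pnatr_eq0.
rewrite scaler_nat mulr2n.
pose Y := \sum_a \sum_d ricci r a d *: (psi *m gam true d *m gam false a).
have -> : \sum_a rho a *m gam false a = Y.
  apply: eq_bigr => a _; rewrite mulmx_suml; apply: eq_bigr => d _.
  by rewrite -scalemxAl.
rewrite {2}/Y exchange_big /= /Y -big_split /= scalerA mulrN mulr_sumr scaleNr
  scaler_suml -sumrN.
apply: eq_bigr => a _; rewrite -big_split (bigD1 a) //= [X in _ + X]big1 => [|d da].
  by rewrite addr0 (gam_sqr true) scalerN -opprD -scalerDl -mulr2n mulr_natl.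
rewrite (ricci_sym rN12 rN34 bianchi d a) -scalerDr (gamMr true) (negPf da) mulr0 oppr0.
by rewrite scale0r sub0r addNr scaler0.
Qed.

(** Contracting once more gives [D = s / (k (n - 1)) psi]; put back, this yields
    [(n - 2) Z a = D gamma_a - (2 / k) rho a]. The witness [P] is [- 2 / k] times the Schouten
    tensor formed from [ricci]. *)
Lemma curvature_rho : exists2 P : 'M[C]_n, P^T = P &
  forall a, Z a = \sum_d P a d *: (psi *m gam true d).
Proof.
pose D := \sum_b Z b *m gam false b.
pose s := \sum_a ricci r a a.
have nE : (n%:R : C) = 2%:R * m%:R by rewrite -mul2n natrM.
have n1 : (n%:R - 1 : C) != 0 by rewrite subr_eq0 pnatr_eq1; apply/eqP; lia.
have n2 : (n%:R - 2%:R : C) != 0 by rewrite subr_eq0 eqr_nat; apply/eqP; lia.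
have DE : D = (s / (k * (n%:R - 1))) *: psi.
  have : \sum_a (2%:R *: rho a) *m gam false a = k *: ((2%:R - n%:R) *: D - n%:R *: D).
    under eq_bigr do rewrite dirac_contraction -scalemxAl.
    rewrite -scaler_sumr; congr (_ *: _).
    under eq_bigr do rewrite mulmxDl (gam_sqr true) -scalemxAl.
    rewrite big_split /= -scaler_sumr; congr (_ + _).
    by rewrite sumr_const card_ord mulNrn scaler_nat.
  under eq_bigr do rewrite -scalemxAl.
  rewrite -scaler_sumr ricci_trace -/s scalerA -scalerBl scalerA => H.
  have kn : k * (2%:R - n%:R - n%:R) != 0.
    rewrite mulf_neq0 // (_ : _ - _ - _ = - 2%:R * (n%:R - 1)); last by ring.
    by rewrite mulf_neq0 // oppr_eq0 pnatr_eq0.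
  apply: (scalerI kn); rewrite -H scalerA; congr (_ *: _).
  by field; rewrite k0 n1.
exists (\matrix_(a, d) ((n%:R - 2%:R)^-1 * ((s / (k * (n%:R - 1)))
  * (a == d)%:R - (2%:R / k) * ricci r a d))).
  apply/matrixP => a d; rewrite !mxE eq_sym.
  by rewrite (ricci_sym rN12 rN34 bianchi d a).
move=> a; apply: (scalerI n2).
have -> : (n%:R - 2%:R) *: Z a = D *m gam true a - (2%:R / k) *: rho a.
  have := congr1 ( *:%R k^-1) (dirac_contraction a);
    rewrite -/D !scalerA mulVf // scale1r.
  rewrite [2%:R / k]mulrC => ->.
  by rewrite [in RHS]opprD [RHS]addrCA subrr addr0 -scaleNr opprB.
rewrite DE -scalemxAl /rho [in RHS]scaler_sumr scaler_sumr.
transitivity (\sum_d (s / (k * (n%:R - 1)) * (a == d)%:R) *: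
  e d - \sum_d (2%:R / k) *: (ricci r a d *: e d)).
  congr (_ - _); rewrite (bigD1 a) //= eqxx mulr1 big1 ?addr0 // => d da.
  by rewrite eq_sym (negPf da) mulr0 scale0r.
rewrite -sumrB; apply: eq_bigr => d _.
by rewrite mxE [in RHS]scalerA mulVKf // scalerBl scalerA.
Qed.

End DiracTrick.

(** * The spin connection and conformal Killing spinors *)

(** Letting the skew matrix [w] act on both indices of [g] amounts to replacing the coefficients
    [w'] by their commutator with [w]. *)
Lemma skew_rep_sum (F : comPzRingType) (V : lmodType F) k (w w' : 'M[F]_k)
    (g : 'I_k -> 'I_k -> V) :
  w^T = - w ->
  \sum_al \sum_be w' al be *: (\sum_s (w s al *: g s be + w s be *: g al s))
  = \sum_al \sum_be (w *m w' - w' *m w) al be *: g al be.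
Proof.
move=> wT; transitivity (\sum_al \sum_be \sum_s (w' al be * w s al) *: g s be
     + \sum_al \sum_be \sum_s (w' al be * w s be) *: g al s).
  rewrite -big_split; apply: eq_bigr => al _ /=.
  rewrite -big_split; apply: eq_bigr => be _ /=.
  rewrite scaler_sumr -big_split.
  by apply: eq_bigr => s _; rewrite scalerDr !scalerA.
transitivity (\sum_al \sum_be \sum_s ((w al s * w' s be) *: g al be)
     + \sum_al \sum_be \sum_s ((w' al s * w be s) *: g al be)).
  congr (_ + _).
    rewrite exchange_big [RHS]exchange_big; apply: eq_bigr => be _.
    rewrite exchange_big; apply: eq_bigr => al _; apply: eq_bigr => s _.
    by rewrite mulrC.
  by apply: eq_bigr => al _; rewrite exchange_big.
rewrite -big_split; apply: eq_bigr => al _; rewrite -big_split;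
  apply: eq_bigr => be _ /=.
rewrite -!scaler_suml -scalerDl; congr (_ *: _); rewrite !mxE -sumrN; congr (_ + _).
apply: eq_bigr => s _; rewrite (_ : w be s = - w s be) ?mulrN //.
by have /matrixP/(_ s be) := wT; rewrite !mxE.
Qed.

Section SpinRepresentation.
Variables (R : realType) (m : nat) (gam : gamma_family R m).
Hypothesis hgam : clifford gam.
Local Notation C := (Cplx R).
Local Notation n := m.*2.
Local Notation N := (sdim m).

Definition spin_rep b (w : 'M[C]_n) : 'M[C]_N :=
  - (4%:R^-1 *: \sum_al \sum_be w al be *: (gam b al *m gam (~~ b) be)).

Fact spin_rep_is_linear b : linear (spin_rep b).
Proof.
move=> k u v; rewrite /spin_rep scalerN -opprD scalerA mulrC -scalerA -scalerDr;
  congr (- (_ *: _)).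
rewrite scaler_sumr -big_split; apply: eq_bigr => a _ /=.
rewrite scaler_sumr -big_split; apply: eq_bigr => c _ /=.
by rewrite !mxE scalerDl scalerA.
Qed.
HB.instance Definition _ b :=
  GRing.isLinear.Build C 'M[C]_n 'M[C]_N _ (spin_rep b) (spin_rep_is_linear b).

Lemma gam3E b al de x :
  gam b al *m gam (~~ b) de *m gam b x
  = - (2%:R * (de == x)%:R) *: gam b al + (2%:R * (al == x)%:R) *: gam b de
    + gam b x *m (gam (~~ b) al *m gam b de).
Proof.
have E := gamM hgam (~~ b) de x; rewrite negbK in E.
rewrite -[in LHS]mulmxA E mulmxBr mulmxN mul_mx_scalar [gam b al *m (_ *m _)]mulmxA.
rewrite (gamM hgam b al x) mulmxBl mulNmx mul_scalar_mx opprB opprK.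
by rewrite [in RHS]scaleNr [in RHS]mulmxA addrA addrAC.
Qed.

(** The commutator of a bivector with a vector is a vector. By skewness the two delta terms of
    [gam3E] add up to a factor 4, which the normalisation of [spin_rep] removes. *)
Lemma spin_rep_gam b (w : 'M[C]_n) x : w^T = - w ->
  spin_rep b w *m gam b x = gam b x *m spin_rep (~~ b) w + \sum_al w al x *: gam b al.
Proof.
move=> wT; have wN i j : w j i = - w i j.
  by have /matrixP/(_ i j) := wT; rewrite !mxE.
rewrite /spin_rep negbK mulNmx -scalemxAl mulmxN -scalemxAr.
have -> : (\sum_al \sum_be w al be *: (gam b al *m gam (~~ b) be)) *m gam b x
  = gam b x *m (\sum_al \sum_be w al be *: (gam (~~ b) al *m gam b be))
    - 4%:R *: \sum_al w al x *: gam b al.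
  transitivity (\sum_al \sum_be (w al be *: (gam b x *m (gam (~~ b) al *m gam b be))
     + ((w al be * (- (2%:R * (be == x)%:R))) *:
       gam b al + (w al be * (2%:R * (al == x)%:R)) *: gam b be))).
    rewrite mulmx_suml; apply: eq_bigr => al _; rewrite mulmx_suml;
      apply: eq_bigr => be _.
    by rewrite -scalemxAl gam3E addrC scalerDr scalerDr !scalerA.
  under eq_bigr do rewrite big_split /=.
  rewrite big_split /=; congr (_ + _).
    rewrite mulmx_sumr; apply: eq_bigr => al _; rewrite mulmx_sumr;
      apply: eq_bigr => be _.
    by rewrite -scalemxAr.
  under eq_bigr do rewrite big_split /=.
  rewrite big_split /= [X in _ + X]exchange_big -big_split /= scaler_sumr -sumrN.
  apply: eq_bigr => al _.
  rewrite (bigD1 x) //= [X in _ + X + _]big1 => [|be bx]; last first.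
    by rewrite (negPf bx) mulr0 oppr0 mulr0 scale0r.
  rewrite (bigD1 x) //= [X in _ + (_ + X)]big1 => [|be bx]; last first.
    by rewrite (negPf bx) !mulr0 scale0r.
  rewrite !addr0 eqxx mulr1 (wN al x) -scalerDl scalerA -scaleNr; congr (_ *: _); ring.
rewrite scalerBr opprB scalerA mulVf ?pnatr_eq0 // scale1r addrC.
by [].
Qed.

(** The algebraic content of Clifford multiplication being parallel. *)
Lemma clmx_spin_rep b (w : 'M[C]_n) (psi : 'rV[C]_N) : w^T = - w ->
  clmx gam b (psi *m spin_rep b w)
  = w^T *m clmx gam b psi + clmx gam b psi *m spin_rep (~~ b) w.
Proof.
move=> wT; apply/row_matrixP => x.
have rowE y phi : row y (clmx gam b phi) = phi *m gam b y by apply/rowP => B;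
  rewrite !mxE.
rewrite rowE -mulmxA spin_rep_gam // mulmxDr mulmxA linearD /= !row_mul rowE addrC.
congr (_ + _); rewrite [RHS]mulmx_sum_row mulmx_sumr; apply: eq_bigr => al _.
by rewrite -scalemxAr rowE !mxE.
Qed.

(** The commutator with [spin_rep b w] is a derivation, so [spin_rep_gam] determines it on each
    factor of a product of two gammas. *)
Lemma spin_rep_comm b (w w' : 'M[C]_n) : w^T = - w -> w'^T = - w' ->
  spin_rep b w *m spin_rep b w' - spin_rep b w' *m spin_rep b w
  = spin_rep b (w *m w' - w' *m w).
Proof.
move=> wT w'T.
pose g al be := gam b al *m gam (~~ b) be.
have g2 al be : spin_rep b w *m g al be - g al be *m spin_rep b w
     = \sum_s (w s al *: g s be + w s be *: g al s).
  rewrite /g mulmxA spin_rep_gam // mulmxDl -mulmxA spin_rep_gam // negbK mulmxDr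
    mulmxA.
  rewrite addrAC [_ + _ - _]addrAC subrr add0r addrC big_split /= mulmx_suml mulmx_sumr.
  congr (_ + _); apply: eq_bigr => s _; by rewrite -?scalemxAl -?scalemxAr.
have repE v : spin_rep b v = - (4%:R^-1 *: \sum_al \sum_be v al be *: g al be) by [].
rewrite (repE w') (repE (_ - _)) -skew_rep_sum //; move: (spin_rep b w) g2 => r g2.
rewrite mulmxN mulNmx opprK addrC -scalemxAr -scalemxAl -scalerBr -scalerN;
  congr (_ *: _).
rewrite mulmx_sumr mulmx_suml -sumrB -sumrN; apply: eq_bigr => al _ /=.
rewrite mulmx_sumr mulmx_suml -sumrB -sumrN; apply: eq_bigr => be _ /=.
by rewrite -scalemxAr -scalemxAl -scalerBr -g2 -scalerN opprB.
Qed.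

End SpinRepresentation.

(** [E] is an orthonormal frame, [M] the metric, [Ga] a Christoffel matrix. In the derivative of
    [E M E^T = 1] the terms with [Ga] cancel, leaving [w + w^T = 0]. *)
Lemma skew_of_metric (F : comPzRingType) k (w E M Ga : 'M[F]_k) :
  E *m M *m E^T = 1%:M ->
  ((w *m E - E *m Ga) *m M + E *m (Ga *m M + M *m Ga^T)) *m E^T
    + E *m M *m (w *m E - E *m Ga)^T = 0 ->
  w^T = - w.
Proof.
move=> EM; have -> : (w *m E - E *m Ga) *m M + E *m (Ga *m M + M *m Ga^T)
    = w *m E *m M + E *m M *m Ga^T.
  by rewrite mulmxBl mulmxDr !mulmxA addrA addrNK.
have h1 : w *m E *m M *m E^T = w by rewrite -!mulmxA [E *m (M *m _)]mulmxA EM mulmx1.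
have -> : (w *m E - E *m Ga)^T
  = E^T *m w^T - Ga^T *m E^T by rewrite linearB /= !trmx_mul.
rewrite mulmxDl h1 mulmxBr !mulmxA EM mul1mx addrACA subrr addr0 addrC => /eqP.
by rewrite addr_eq0 => /eqP.
Qed.

(** Connection terms drop out of the derivative of [Psi^T Psi = 0]: those in [w] cancel by skewness,
    those in [G] contain [Psi^T Psi]. Partial derivatives may thus be replaced by covariant ones. *)
Lemma isotropic_skew (F : comPzRingType) k l (Psi Y : 'M[F]_(k, l)) (w : 'M[F]_k)
    (G : 'M[F]_l) :
  w^T = - w -> Psi^T *m Psi = 0 ->
  (Y + (w^T *m Psi + Psi *m G))^T *m Psi + Psi^T *m (Y + (w^T *m Psi + Psi *m G))
  = Y^T *m Psi + Psi^T *m Y.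
Proof.
move=> wT PP; have PPG : Psi^T *m (Psi *m G) = 0 by rewrite mulmxA PP mul0mx.
have GPP : G^T *m Psi^T *m Psi = 0 by rewrite -mulmxA PP mulmx0.
have -> : (Y + (w^T *m Psi + Psi *m G))^T = Y^T + (Psi^T *m w + G^T *m Psi^T).
  by rewrite !linearD /= !trmx_mul trmxK.
rewrite !mulmxDl !mulmxDr PPG GPP !addr0 wT mulNmx mulmxN -mulmxA addrACA subrr addr0.
by [].
Qed.

Section Fields.
Variables (R : realType) (m : nat) (X : complex_manifold R m.*2).
Variables (g : holo_metric X) (gam : gamma_family R m) (hgam : clifford gam).
Variables (S : spin_structure g gam) (D : levi_civita S).
Local Notation n := m.*2.
Local Notation N := (sdim m).
Local Notation C := (Cplx R).
Variable c : chart X.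

Lemma dom_pd_mulmx k l r (f : X -> 'M[C]_(k, l)) (h : X -> 'M[C]_(l, r)) p a :
  dom c p -> holo_at c f p -> holo_at c h p ->
  pd c a (fun q => f q *m h q) p = pd c a f p *m h p + f p *m pd c a h p.
Proof. exact: (@pd_mulmx _ _ _ c _ (@subset_refl _ _)). Qed.

Lemma dom_eq_pd (V : normedModType C) (f h : X -> V) p a :
  dom c p -> (forall q, dom c q -> f q = h q) -> pd c a f p = pd c a h p.
Proof. exact: (eq_pd (dom_open c) (@subset_refl _ _)). Qed.

Lemma metric_frame p : dom c p ->
  frame S c p *m (g c p *m (frame S c p)^T) = 1%:M.
Proof. by move=> dp; rewrite mulmxA; exact: frame_orthonormal. Qed.

Lemma frame_metric p : dom c p ->
  (g c p *m (frame S c p)^T) *m frame S c p = 1%:M.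
Proof. by move=> dp; apply: mulmx1C; exact: metric_frame. Qed.

Lemma pd_frame p a : dom c p ->
  pd c a (frame S c) p = conn_form D c p a *m frame S c p - frame S c p *m christoffel
    D c p a.
Proof. by move=> dp; rewrite -(conn_formE D a dp) addrK. Qed.

Lemma conn_form_skew p a : dom c p -> (conn_form D c p a)^T = - conn_form D c p a.
Proof.
move=> dp; set w := conn_form D c p a; set E := frame S c p; set M := g c p.
set Ga := christoffel D c p a.
have hE := frame_holo S dp; have hM := metric_holo g dp.
have hET : holo_at c (fun q => (frame S c q)^T) p by exact:
  (holo_mx_linear (@trmx C n n)).
have hEM := holo_mulmx hE hM.
have : pd c a (fun q => frame S c q *m g c q *m (frame S c q)^T) p = 0.
  rewrite -(@pd_cst _ _ X c _ (1%:M : 'M[C]_n) p a); apply: dom_eq_pd => // q dq.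
  exact: frame_orthonormal.
rewrite (dom_pd_mulmx a dp hEM hET) (dom_pd_mulmx a dp hE hM).
rewrite (pd_mx_linear (@trmx C n n)) // (metric_compat D a dp) (pd_frame a dp).
exact/skew_of_metric/frame_orthonormal.
Qed.

Lemma spin_connE b p a : spin_conn D b c p a = spin_rep gam b (conn_form D c p a).
Proof. by []. Qed.

Lemma cov_tspinor_clmx b (psi : X -> 'rV[C]_N) al p : dom c p -> holo_at c psi p ->
  cov_tspinor D (~~ b) c al (fun q => clmx gam b (psi q)) p
  = clmx gam b (cov_spinor D b c al psi p).
Proof.
move=> dp hpsi; rewrite /cov_tspinor /cov_spinor [RHS]linear_sum; apply: eq_bigr => a _.
rewrite [RHS]linearZ; congr (_ *: _); rewrite /cov_spinor_coord [RHS]linearD.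
rewrite /cov_tspinor_coord (pd_mx_linear (clmx gam b)) // -addrA; congr (_ + _).
exact: (esym (clmx_spin_rep hgam b (psi p) (conn_form_skew a dp))).
Qed.

Lemma geod_tensorE b (psi : chart X -> X -> 'rV[C]_N) p A B E :
  dom c p -> holo_at c (psi c) p ->
  geod_tensor D b psi c p A B E
  = \sum_al clmx gam b (psi c p) al A *
      (cov_spinor D b c al (psi c) p *m slash gam b (row E (clmx gam b (psi c p))^T))
        0 B.
Proof.
move=> dp hpsi; apply: eq_bigr => al _; rewrite cov_tspinor_clmx //.
under eq_bigr do rewrite -mulrA; rewrite -mulr_sumr; congr (_ * _).
rewrite -mul_clmx -row_mul [RHS]mxE [RHS]mxE; apply: eq_bigr => be _.
by rewrite mulrC [in RHS]mxE.
Qed.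

Lemma pure_derivative b (psi : X -> 'rV[C]_N) p al : dom c p ->
  (forall q, dom c q -> holo_at c psi q) ->
  (forall q, dom c q -> (clmx gam b (psi q))^T *m clmx gam b (psi q) = 0) ->
  let dPsi := clmx gam b (cov_spinor D b c al psi p) in
  dPsi^T *m clmx gam b (psi p) + (clmx gam b (psi p))^T *m dPsi = 0.
Proof.
move=> dp hpsi PP dPsi; set Psi := clmx gam b (psi p).
pose f a := clmx gam b (cov_spinor_coord D b c a psi p).
suff fa a : (f a)^T *m Psi + Psi^T *m f a = 0.
  have -> : dPsi = \sum_a frame S c p al a *: f a.
    by rewrite /dPsi [LHS]linear_sum; apply: eq_bigr => a _; exact: linearZ.
  rewrite linear_sum mulmx_suml mulmx_sumr -big_split big1 // => a _ /=.
  by rewrite linearZ /= -scalemxAl -scalemxAr -scalerDr fa scaler0.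
have hP : holo_at c (fun q => clmx gam b (psi q)) p.
  exact: (holo_mx_linear (clmx gam b) (hpsi _ dp)).
have hPT : holo_at c (fun q => (clmx gam b (psi q))^T) p.
  exact: (holo_mx_linear (@trmx C n N) hP).
have : pd c a (fun q => (clmx gam b (psi q))^T *m clmx gam b (psi q)) p = 0.
  by rewrite -(@pd_cst _ _ X c _ (0 : 'M[C]_N) p a); exact: dom_eq_pd.
rewrite (dom_pd_mulmx a dp hPT hP) (pd_mx_linear (@trmx C n N) a hP).
rewrite (pd_mx_linear (clmx gam b) a (hpsi _ dp)) -/Psi => H.
have -> : f a = clmx gam b (pd c a psi p) + ((conn_form D c p a)^T *m Psi
    + Psi *m spin_rep gam (~~ b) (conn_form D c p a)).
  by rewrite -clmx_spin_rep //; [exact: linearD | exact: conn_form_skew].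
set G := spin_rep gam (~~ b) _; set w := conn_form D c p a;
  set Y := clmx gam b (pd c a psi p) in H *.
have wT : w^T = - w by exact: conn_form_skew.
have PP0 : Psi^T *m Psi = 0 by exact: PP.
by rewrite isotropic_skew.
Qed.

Section KillingSpinor.
Hypothesis m0 : (0 < m)%N.
Variables (xi : spinor_field S true) (zeta : spinor_field S false).
Local Notation k := ((sqrtC (2%:R : C))^-1).
Hypothesis killing : forall p, dom c p -> forall al,
  cov_spinor D true c al (xi c) p + k *: (zeta c p *m gam false al) = 0.

Lemma cov_xi p al : dom c p ->
  cov_spinor D true c al (xi c) p = - k *: (zeta c p *m gam false al).
Proof. by move=> dp; apply/eqP; rewrite scaleNr -addr_eq0 killing. Qed.

(** Each gamma squares to [-1], so each of the [n] frame vectors contributes [k *: zeta c p]: the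
    equation determines its auxiliary spinor. *)
Lemma zeta_ofE p : dom c p -> zeta_of D xi c p = zeta c p.
Proof.
move=> dp; rewrite /zeta_of.
have n0 : (n%:R : C) != 0 by rewrite pnatr_eq0 double_eq0 -lt0n.
have s0 : sqrtC (2%:R : C) != 0 by rewrite sqrtC_eq0 pnatr_eq0.
transitivity ((sqrtC 2%:R / n%:R) *: (\sum_(al < n) k *: zeta c p)).
  congr (_ *: _); apply: eq_bigr => al _.
  by rewrite cov_xi // -scalemxAl (gam_sqr hgam false) scalerN scaleNr opprK.
rewrite sumr_const card_ord -[(_ *: _) *+ _]scaler_nat !scalerA -[RHS]scale1r;
  congr (_ *: _).
by field; rewrite s0 n0.
Qed.

Hypothesis xi_pure : forall p, dom c p -> pure gam true (xi c p).

Local Notation Psi p := (clmx gam true (xi c p)).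

Lemma Psi_isotropic p : dom c p -> (Psi p)^T *m Psi p = 0.
Proof. by move=> dp; apply/(pure_clmx hgam); [case: (xi_pure dp) | exact: xi_pure]. Qed.

Lemma row_Psi_null p A : dom c p -> (row A (Psi p)^T <= null_space gam true (xi c
  p))%MS.
Proof.
by move=> dp; apply: submx_trans (row_sub _ _) _;
  rewrite (pure_null_space hgam (xi_pure dp)).
Qed.

Lemma geod_xi p A B E : dom c p ->
  geod_tensor D true xi c p A B E
  = - k * (zeta c p *m slash gam false (row A (Psi p)^T)
    *m slash gam true (row E (Psi p)^T)) 0 B.
Proof.
move=> dp; rewrite geod_tensorE //; last exact: scomp_holo.
move: (slash gam true (row E _)) => G.
transitivity ((\sum_al (Psi p) al A *: (cov_spinor D true c al (xi c) p *m G)) 0 B).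
  by rewrite summxE; apply: eq_bigr => al _; rewrite [RHS]mxE.
under eq_bigr do rewrite cov_xi // -!scalemxAl scalerA mulrC -scalerA.
rewrite -scaler_sumr mxE; congr (_ * _).
rewrite /slash mulmx_sumr mulmx_suml !summxE; apply: eq_bigr => al _.
have -> : row A (Psi p)^T 0 al = Psi p al A by rewrite mxE mxE.
by rewrite -scalemxAr -scalemxAl.
Qed.

Lemma geod_xi_sym p A B E : dom c p -> sym12 (geod_tensor D true xi c p) A B E = 0.
Proof.
move=> dp; rewrite /sym12 !geod_xi // -mulrDr.
have nE A' := row_Psi_null A' dp.
have xi0 : xi c p != 0 by case: (xi_pure dp).
rewrite !(slash_null hgam (zeta c p) xi0 (nE _) (nE E) false) /=.
set chi := zeta c p *m _; rewrite !slash_row.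
suff H : (Psi p)^T *m clmx gam true chi + (clmx gam true chi)^T *m Psi p = 0.
  have HAB : ((Psi p)^T *m clmx gam true chi) A B + ((Psi p)^T *m clmx gam true chi)
    B A = 0.
    have /matrixP/(_ A B) := H; rewrite mxE [RHS]mxE => <-; congr (_ + _).
    by rewrite -[in RHS](trmxK (Psi p)) -trmx_mul [RHS]mxE.
  rewrite [X in _ * (_ * (X + _))]mxE [X in _ * (_ * (_ + X))]mxE.
  rewrite [X in _ * (_ * (- X + _))]mxE [X in _ * (_ * (_ - X))]mxE.
  by rewrite -opprD HAB oppr0 !mulr0.
(* Up to the factor [- k], [chi] is the derivative of [xi] along the [E]-th column of [Psi], so
   [pure_derivative] applies to it. *)
have -> : chi = \sum_al (row E (Psi p)^T) 0 al *: (zeta c p *m gam false al).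
  by rewrite /chi /slash mulmx_sumr; apply: eq_bigr => al _; rewrite -scalemxAr.
rewrite (linear_sum (clmx gam true)) mulmx_sumr (linear_sum (@trmx C n N)) mulmx_suml.
rewrite -big_split big1 // => al _ /=; rewrite linearZ (linearZ_LR (@trmx C n N)) /=.
rewrite -scalemxAl -scalemxAr -scalerDr.
have k0 : - k != 0 :> C by rewrite oppr_eq0 invr_eq0 sqrtC_eq0 pnatr_eq0.
have := pure_derivative al dp (fun q dq => scomp_holo xi dq) Psi_isotropic.
rewrite /= cov_xi // linearZ (linearZ_LR (@trmx C n N))
  /= -scalemxAl -scalemxAr -scalerDr.
by move=> /eqP; rewrite scaler_eq0 (negPf k0) addrC => /eqP ->; rewrite scaler0.
Qed.

Lemma star_atE p : dom c p ->
  star_at gam (xi c p) (zeta c p) <->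
  forall A B E, geod_tensor D true xi c p A B E = 0.
Proof.
move=> dp; have k0 : - k != 0 :> C by rewrite oppr_eq0 invr_eq0 sqrtC_eq0 pnatr_eq0.
split=> [st A B E|H].
  by rewrite geod_xi // (star_at_slash hgam (xi_pure dp) st)
    ?row_Psi_null // mxE mulr0.
apply: (null_null_star hgam m0 (xi_pure dp)) => A E; apply/rowP => B; rewrite [RHS]mxE.
have /eqP := H A B E; rewrite geod_xi // mulf_eq0 (negPf k0) /= => /eqP.
exact.
Qed.

(** Differentiating [Z . xi = 0] moves the derivative from [Z] to [xi], where the Killing equation
    replaces it. *)
Lemma cov_null_section (U : set X) (Z : X -> 'rV[C]_n) p al : open U -> U `<=` dom c ->
  null_section xi c U Z -> U p ->
  cov_vector D c al Z p *m Psi p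
    = k *: (zeta c p *m gam false al *m slash gam true (Z p)).
Proof.
move=> Uo Ud nZ Up; have dp := Ud _ Up.
suff H : cov_vector D c al Z p *m Psi p + Z p *m clmx gam true (cov_spinor D true c al
  (xi c) p) = 0.
  move/eqP: H; rewrite addr_eq0 => /eqP ->; rewrite mul_clmx cov_xi // -scalemxAl.
  by rewrite scaleNr opprK.
rewrite /cov_vector /cov_spinor (linear_sum (clmx gam true)) mulmx_suml mulmx_sumr.
rewrite -big_split big1 // => a _ /=.
rewrite (linearZ_LR (clmx gam true)) /= -scalemxAl -scalemxAr -scalerDr.
have -> : clmx gam true (cov_spinor_coord D true c a (xi c) p)
    = clmx gam true (pd c a (xi c) p) + ((conn_form D c p a)^T *m Psi p
    + Psi p *m spin_rep gam false (conn_form D c p a)).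
  by rewrite -(clmx_spin_rep hgam true) //; [exact: linearD | exact: conn_form_skew].
have [hZ _] := nZ p Up; have hxi := scomp_holo xi dp.
have hP : holo_at c (fun q => clmx gam true (xi c q)) p.
  exact: (holo_mx_linear (clmx gam true) hxi).
have ZP q : U q -> Z q *m Psi q = 0.
  by move=> Uq; have [_] := nZ q Uq; rewrite sub_null_space => /eqP.
have : pd c a (fun q => Z q *m Psi q) p = 0.
  by rewrite -(@pd_cst _ _ X c _ (0 : 'rV[C]_N) p a); apply: (eq_pd Uo Ud).
rewrite (dom_pd_mulmx a dp hZ hP) (pd_mx_linear (clmx gam true) a hxi) => H.
rewrite /cov_vector_coord conn_form_skew // mulmxDl !mulmxDr mulNmx mulmxN !mulmxA ZP
  //.
by rewrite mul0mx addr0 addrACA H add0r subrr scaler0.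
Qed.

Lemma null_section_deriv (U : set X) (Y Z : X -> 'rV[C]_n) p : open U -> U `<=` dom c ->
  null_section xi c U Z -> U p ->
  (\sum_al Y p 0 al *: cov_vector D c al Z p) *m Psi p
  = k *: (zeta c p *m slash gam false (Y p) *m slash gam true (Z p)).
Proof.
move=> Uo Ud nZ Up; move E : (slash gam true (Z p)) => G.
rewrite mulmx_suml [zeta c p *m _]mulmx_sumr mulmx_suml scaler_sumr.
apply: eq_bigr => al _; rewrite -scalemxAl (cov_null_section al Uo Ud nZ Up) E.
by rewrite -scalemxAr -scalemxAl !scalerA mulrC.
Qed.

Lemma star_totally_geodetic (U : set X) (Y Z : X -> 'rV[C]_n) p :
  open U -> U `<=` dom c ->
  star_at gam (xi c p) (zeta c p) ->
  null_section xi c U Y -> null_section xi c U Z -> U p ->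
  ((\sum_al Y p 0 al *: cov_vector D c al Z p)%R <= null_space gam true (xi c p))%MS.
Proof.
move=> Uo Ud st nY nZ Up; rewrite sub_null_space (null_section_deriv _ Uo Ud nZ Up).
have [[_ Yp] [_ Zp]] := (nY p Up, nZ p Up).
by rewrite (star_at_slash hgam (xi_pure (Ud _ Up)) st) // scaler0.
Qed.

(** These sections span N_xi at every point, so total geodesy can be tested on them without
    extending null vectors. *)
Lemma row_null_section A : null_section xi c (dom c) (fun q => row A (Psi q)^T).
Proof.
move=> q dq; split; last exact: row_Psi_null.
apply: (@holo_mx_linear _ _ _ _ _ _ _ _ (row A)).
apply: (holo_mx_linear (@trmx C n N)); apply: (holo_mx_linear (clmx gam true)).
exact: scomp_holo.
Qed.

Lemma totally_geodetic_star p : dom c p ->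
  (forall A E, ((\sum_al row A (Psi p)^T 0 al *: cov_vector D c al (fun q =>
    row E (Psi q)^T) p)%R
     <= null_space gam true (xi c p))%MS) ->
  star_at gam (xi c p) (zeta c p).
Proof.
move=> dp H; apply: (null_null_star hgam m0 (xi_pure dp)) => A E.
have := H A E; rewrite sub_null_space.
rewrite (@null_section_deriv _ (fun q =>
  row A (Psi q)^T) _ p (dom_open c) (@subset_refl _ _) (row_null_section E) dp).
by rewrite scaler_eq0 invr_eq0 sqrtC_eq0 pnatr_eq0 /= => /eqP.
Qed.

End KillingSpinor.

End Fields.

(** * Curvature *)

Section Curvature.
Variables (R : realType) (m : nat) (X : complex_manifold R m.*2).
Variables (g : holo_metric X) (gam : gamma_family R m) (hgam : clifford gam).
Variables (S : spin_structure g gam) (D : levi_civita S).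
Local Notation n := m.*2.
Local Notation N := (sdim m).
Local Notation C := (Cplx R).
Variable c : chart X.

Local Notation E := (frame S c).
Local Notation w a := (fun q => conn_form D c q a).
Local Notation Ga a := (fun q => christoffel D c q a).
(** The inverse of the frame matrix, by orthonormality; this form is visibly holomorphic. *)
Definition coframe q := g c q *m (E q)^T.
Local Notation Einv := coframe.

(** Connection matrices act on rows from the right, whence the order of the factors in the
    commutator. *)
Definition curvature_of (h : 'I_n -> X -> 'M[C]_n) a b p :=
  pd c a (h b) p - pd c b (h a) p + (h b p *m h a p - h a p *m h b p).

Lemma pd_mulmxB k l l' r (f : X -> 'M[C]_(k, l)) (h : X -> 'M[C]_(l, r))
    (f' : X -> 'M[C]_(k, l')) (h' : X -> 'M[C]_(l', r)) p a :
  dom c p -> holo_at c f p -> holo_at c h p -> holo_at c f' p -> holo_at c h' p ->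
  holo_at c (fun q => f q *m h q - f' q *m h' q) p /\
  pd c a (fun q => f q *m h q - f' q *m h' q) p
  = (pd c a f p *m h p + f p *m pd c a h p)
    - (pd c a f' p *m h' p + f' p *m pd c a h' p).
Proof.
move=> dp hf hh hf' hh'; have h1 := holo_mulmx hf hh; have h2 := holo_mulmx hf' hh'.
split; first exact: holoB h1 h2.
by rewrite (pdB a h1 h2) !dom_pd_mulmx.
Qed.

Lemma frame_curvature_algebra
    (F : comPzRingType) k (E0 wa wb ga gb dawb dbwa dagb dbga : 'M[F]_k) :
  (dbwa *m E0 + wa *m (wb *m E0 - E0 *m gb)) - ((wb *m E0 - E0 *m gb)
    *m ga + E0 *m dbga)
  = (dawb *m E0 + wb *m (wa *m E0 - E0 *m ga)) - ((wa *m E0 - E0 *m ga)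
    *m gb + E0 *m dagb) ->
  (dawb - dbwa + (wb *m wa - wa *m wb)) *m E0
    = E0 *m (dagb - dbga + (gb *m ga - ga *m gb)).
Proof.
rewrite !(mulmxDl, mulmxDr, mulmxN, mulNmx) !mulmxA.
move: (dbwa *m E0) (wa *m wb *m E0) (wa *m E0 *m gb) (wb *m E0 *m ga) (E0 *m gb *m ga)
  (E0 *m dbga) (dawb *m E0) (wb *m wa *m E0) (E0 *m ga *m gb) (E0 *m dagb)
  => a1 a2 a3 a4 a5 a6 a7 a8 a9 a10 H.
apply/eqP; rewrite -subr_eq0; apply/eqP; move/eqP: H; rewrite -subr_eq0 => /eqP H.
rewrite -[RHS]oppr0 -{}H; apply/matrixP => i j; rewrite !mxE; ring.
Qed.

(** The second derivatives of the frame, expressed through [pd_frame], are equated in both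
    orders. *)
Lemma frame_curvature p a b : dom c p ->
  curvature_of (fun a q => conn_form D c q a) a b p *m E p
  = E p *m curvature_of (fun a q => christoffel D c q a) a b p.
Proof.
move=> dp; have hE := frame_holo S dp.
have hw x := conn_form_holo D x dp; have hg x := christoffel_holo D x dp.
have [ha Ea] := pd_mulmxB b dp (hw a) hE hE (hg a).
have [hb Eb] := pd_mulmxB a dp (hw b) hE hE (hg b).
have := @pd_comm _ _ _ c _ (dom_open c) (@subset_refl _ _) _ _ (frame S c) _ _ p a b dp
  (fun q dq => frame_holo S dq) (fun q dq => pd_frame D a dq) (fun q dq =>
    pd_frame D b dq) ha hb.
rewrite Ea Eb !(pd_frame D _ dp); exact: frame_curvature_algebra.
Qed.

Lemma pd_entry k l (f : X -> 'M[C]_(k, l)) p a i j : holo_at c f p ->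
  (pd c a f p) i j = pd c a (fun q => f q i j) p.
Proof. exact: derive_entry. Qed.

(** Symmetry in the direction and row indices cancels the derivative terms and the products in
    pairs. *)
Lemma bianchi_algebra (F : comPzRingType) k (dG : 'I_k -> 'I_k -> 'M[F]_k)
    (G : 'I_k -> 'M[F]_k) :
  (forall a b d, G a b d = G b a d) ->
  (forall x a b d, dG x a b d = dG x b a d) ->
  let K a b := dG a b - dG b a + (G b *m G a - G a *m G b) in
  forall a b e d, K a b e d + K b e a d + K e a b d = 0.
Proof.
move=> GT dGT K a b e d; have GGT x y z u : (G x *m G y) z u = (G z *m G y) x u.
  by rewrite !mxE; apply: eq_bigr => s _; rewrite (GT x z).
have KE x y z u : K x y z u = dG x y z u - dG y x z u + ((G y *m G x)
  z u - (G x *m G y) z u).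
  by rewrite /K; move: (G x *m G y) (G y *m G x) => A B; rewrite !mxE.
rewrite !KE (dGT a b e) (dGT b e a) (dGT e a b) (GGT b a e) (GGT e b a) (GGT a e b).
ring.
Qed.

Lemma christoffel_bianchi p a b e d : dom c p ->
  let K := curvature_of (fun a q => christoffel D c q a) in
  K a b p e d + K b e p a d + K e a p b d = 0.
Proof.
move=> dp K; have hg x := christoffel_holo D x dp.
have T x y z u : (pd c x (Ga y) p) z u = (pd c x (Ga z) p) y u.
  apply: etrans (pd_entry x z u (hg y)) (etrans _ (esym (pd_entry x y u (hg z)))).
  by apply: dom_eq_pd => // q dq; exact: torsion_free.
exact: (@bianchi_algebra _ _ (fun x y => pd c x (Ga y) p) (fun x => Ga x p)
  (torsion_free D dp) T a b e d).
Qed.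

Lemma conn_curvature_skew p a b : dom c p ->
  let Om := curvature_of (fun a q => conn_form D c q a) in
  (Om a b p)^T = - Om a b p.
Proof.
move=> dp Om; have hw x := conn_form_holo D x dp.
have T x y : (pd c x (w y) p)^T = - pd c x (w y) p.
  rewrite -(pd_mx_linear (@trmx C n n)) //.
  transitivity (pd c x (fun q => - conn_form D c q y) p).
    by apply: dom_eq_pd => // q dq; exact: conn_form_skew.
  exact: (pd_mx_linear (@GRing.opp 'M[C]_n) x (hw y)).
have wwT x y : (conn_form D c p x *m conn_form D c p y)^T
  = conn_form D c p y *m conn_form D c p x.
  by rewrite trmx_mul !conn_form_skew // mulNmx mulmxN opprK.
rewrite /Om /curvature_of.
move: (pd c a (w b) p) (pd c b (w a) p) (T a b) (T b a) (wwT a b) (wwT b a) =>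
  A B AT BT.
move: (_ *m _) (_ *m _) => G H GT HT.
by rewrite linearD linearB /= linearB /= AT BT GT HT !opprD !opprK; congr (_ + _);
  rewrite addrC.
Qed.

(** The terms in [s4], the connection of the other chirality, cancel: Clifford multiplication is
    parallel. *)
Lemma second_derivative_algebra (F : comPzRingType) l (k : F) (Z z ps : 'rV[F]_l)
    (tx ty sl s1 s2 s3 s4 : 'M[F]_l) :
  - k *: ((Z - z *m s4) *m tx + z *m (sl - (tx *m s3 - s4 *m tx))) -
  ((- k *: (z *m ty) - ps *m s3) *m s2 + ps *m s1) =
  - k *: (Z *m tx + z *m sl) + (k *: (z *m tx *m s3) + k *: (z *m ty *m s2)) +
  (ps *m (s3 *m s2) - ps *m s1).
Proof.
rewrite !(mulmxDl, mulmxDr, mulmxN, mulNmx) -!scalemxAl !mulmxA.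
move: (Z *m tx) (z *m s4 *m tx) (z *m sl) (z *m tx *m s3) (z *m ty *m s2)
  (ps *m s3 *m s2)
  (ps *m s1) => a1 a2 a3 a4 a5 a6 a7.
by apply/rowP => i; rewrite !mxE; ring.
Qed.

(** [G] and [T + U] stand for the parts that are symmetric in the two directions and cancel between
    the two orders of differentiation. *)
Lemma commutator_algebra (F : comPzRingType) l (k : F) (Za Zb ps G T U : 'rV[F]_l)
    (ta tb sa sb dsab dsba : 'M[F]_l) :
  - k *: (Zb *m ta + G) + (T + U) + (ps *m (sb *m sa) - ps *m dsba)
  = - k *: (Za *m tb + G) + (U + T) + (ps *m (sa *m sb) - ps *m dsab) ->
  ps *m (dsab - dsba + (sb *m sa - sa *m sb)) = k *: (Zb *m ta - Za *m tb).
Proof.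
rewrite !(mulmxDl, mulmxDr, mulmxN, mulNmx).
move: (Za *m tb) (Zb *m ta) (ps *m (sb *m sa)) (ps *m (sa *m sb)) (ps *m dsab)
  (ps *m dsba)
  => a1 a2 a3 a4 a5 a6 /eqP; rewrite -subr_eq0 => /eqP H.
apply/eqP; rewrite -subr_eq0; apply/eqP; rewrite -[RHS]H.
by apply/rowP => i; rewrite !mxE; ring.
Qed.

Section Integrability.
Variables (xi : spinor_field S true) (zeta : spinor_field S false) (k : C).
Hypothesis killing : forall p, dom c p -> forall al,
  cov_spinor D true c al (xi c) p = - k *: (zeta c p *m gam false al).

Local Notation Om := (curvature_of (fun a q => conn_form D c q a)).
(** Clifford multiplication by the [a]-th coordinate vector field, whose frame components form the
    [a]-th row of [coframe]. *)
Definition coframe_gam a q := slash gam false (row a (Einv q)).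
Local Notation theta := coframe_gam.
Local Notation cov_zeta a p := (cov_spinor_coord D false c a (zeta c) p).

Lemma cov_spinor_coordE b (psi : X -> 'rV[C]_N) p a : dom c p ->
  cov_spinor_coord D b c a psi p = \sum_al Einv p a al *: cov_spinor D b c al psi p.
Proof.
move=> dp; under eq_bigr do rewrite scaler_sumr.
rewrite exchange_big (bigD1 a) //= [X in _ + X]big1 => [|d da].
  under eq_bigr do rewrite scalerA.
  rewrite addr0 -scaler_suml (_ : \sum_i _ = 1) ?scale1r //.
  by have /matrixP/(_ a a) := frame_metric S dp; rewrite [RHS]mxE eqxx mxE.
under eq_bigr do rewrite scalerA.
rewrite -scaler_suml (_ : \sum_i _ = 0) ?scale0r //.
by have /matrixP/(_ a d) := frame_metric S dp; rewrite [RHS]mxE eq_sym (negPf da) mxE.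
Qed.

Lemma pd_xi p a : dom c p ->
  pd c a (xi c) p = - k *: (zeta c p *m theta a p)
    - xi c p *m spin_rep gam true (conn_form D c p a).
Proof.
move=> dp; apply/eqP; rewrite eq_sym subr_eq eq_sym; apply/eqP.
rewrite -[LHS]/(cov_spinor_coord D true c a (xi c) p) cov_spinor_coordE //.
rewrite /theta /slash [zeta c p *m _]mulmx_sumr scaler_sumr; apply: eq_bigr => al _.
rewrite killing // -scalemxAr !scalerA mulrC; congr (_ *: _).
by rewrite [in RHS]mxE.
Qed.

Lemma pd_Einv p a : dom c p -> holo_at c Einv p /\
  pd c a Einv p = christoffel D c p a *m Einv p - Einv p *m conn_form D c p a.
Proof.
move=> dp; have hE := frame_holo S dp; have hM := metric_holo g dp.
have hET : holo_at c (fun q => (E q)^T) p by exact: (holo_mx_linear (@trmx C n n)).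
split; first exact: holo_mulmx hM hET.
rewrite (dom_pd_mulmx a dp hM hET) (pd_mx_linear (@trmx C n n) a hE).
rewrite (metric_compat D a dp) (pd_frame D a dp) linearB /= !trmx_mul conn_form_skew //.
by rewrite mulmxDl mulmxBr !mulmxN !mulmxA addrACA subrr addr0.
Qed.

Lemma theta_spin_rep p a b : dom c p ->
  theta a p *m spin_rep gam true (conn_form D c p b)
  = spin_rep gam false (conn_form D c p b) *m theta a p
    + slash gam false (row a (Einv p *m conn_form D c p b)).
Proof.
move=> dp; have wT := conn_form_skew D b dp; set v := conn_form D c p b in wT *.
rewrite /theta /slash [X in X = _]mulmx_suml [spin_rep _ _ _ *m _]mulmx_sumr.
transitivity (\sum_x (Einv p) a x *: (spin_rep gam false v *m gam false x)
   - \sum_x (Einv p) a x *: (\sum_al v al x *: gam false al)).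
  rewrite -sumrB; apply: eq_bigr => x _; rewrite -scalemxAl -scalerBr [row _ _ _ _]mxE.
  by rewrite (spin_rep_gam hgam false x wT) addrK.
congr (_ + _).
  by apply: eq_bigr => x _; rewrite -scalemxAr [row _ _ _ _]mxE.
under eq_bigr do rewrite scaler_sumr.
rewrite exchange_big -sumrN; apply: eq_bigr => al _ /=.
rewrite [row _ _ _ _]mxE [(_ *m _) a al]mxE scaler_suml -sumrN; apply: eq_bigr => x _.
rewrite scalerA -scaleNr; congr (_ *: _).
by have /matrixP/(_ al x) := wT; rewrite !mxE => ->; rewrite mulrN.
Qed.

(** Torsion-freeness removes the Christoffel terms from the commutator of derivatives of [xi]. *)
Lemma row_christoffel_sym p a b : dom c p ->
  row a (christoffel D c p b *m Einv p) = row b (christoffel D c p a *m Einv p).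
Proof.
move=> dp; apply/rowP => x; rewrite [LHS]mxE [RHS]mxE [LHS]mxE [RHS]mxE.
by apply: eq_bigr => d _; rewrite (torsion_free D dp).
Qed.

Lemma pd_theta p a b : dom c p -> holo_at c (theta a) p /\
  pd c b (theta a) p = slash gam false (row a (christoffel D c p b *m Einv p))
     - slash gam false (row a (Einv p *m conn_form D c p b)).
Proof.
move=> dp; have [hEi dEi] := pd_Einv b dp.
have hr : holo_at c (fun q => row a (Einv q)) p by exact: (holo_mx_linear (row a) hEi).
split; first exact: (holo_mx_linear (slash gam false) hr).
rewrite (pd_mx_linear (slash gam false) b hr) (pd_mx_linear (row a) b hEi) dEi.
by rewrite !linearB.
Qed.

Lemma pd_spin_rep s p a b : dom c p ->
  holo_at c (fun q => spin_rep gam s (conn_form D c q a)) p /\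
  pd c b (fun q => spin_rep gam s (conn_form D c q a)) p
    = spin_rep gam s (pd c b (w a) p).
Proof.
move=> dp; have hw := conn_form_holo D a dp.
split; first exact: (holo_mx_linear (spin_rep gam s) hw).
exact: (pd_mx_linear (spin_rep gam s) b hw).
Qed.

(** The integrability condition of the Killing equation: [pd_xi] is differentiated again and the
    second derivatives commute. By [spin_rep_comm] the terms in [xi] combine into the spin
    curvature. *)
Lemma spin_curvature p a b : dom c p ->
  xi c p *m spin_rep gam true (Om a b p)
  = k *: (cov_zeta b p *m theta a p - cov_zeta a p *m theta b p).
Proof.
move=> dp; have hxi := scomp_holo xi dp; have hz := scomp_holo zeta dp.
have H x y : holo_at c (fun q => - k *:
  (zeta c q *m theta x q) - xi c q *m spin_rep gam true (conn_form D c q x)) p /\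
  pd c y (fun q => - k *: (zeta c q *m theta x q)
    - xi c q *m spin_rep gam true (conn_form D c q x)) p
  = - k *: (cov_zeta y p *m theta x p + zeta c p *m slash gam false (row x (christoffel
    D c p y *m Einv p)))
    + (k *: (zeta c p *m theta x p *m spin_rep gam true (conn_form D c p y))
       + k *: (zeta c p *m theta y p *m spin_rep gam true (conn_form D c p x)))
    + (xi c p *m (spin_rep gam true (conn_form D c p y)
      *m spin_rep gam true (conn_form D c p x))
       - xi c p *m spin_rep gam true (pd c y (w x) p)).
  have [ht dt] := pd_theta x y dp; have [hs ds] := pd_spin_rep true x y dp.
  have h1 := holo_mulmx hz ht; have h2 := holo_mulmx hxi hs.
  have h1' : holo_at c (fun q => - k *: (zeta c q *m theta x q)) p.
    exact: (holo_mx_linear ( *:%R (- k)) h1).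
  split; first exact: holoB h1' h2.
  rewrite (pdB y h1' h2) (dom_pd_mulmx y dp hxi hs) ds pd_xi //.
  rewrite (pd_mx_linear ( *:%R (- k)) y h1) (dom_pd_mulmx y dp hz ht) dt.
  have -> : pd c y (zeta c) p = cov_zeta y p - zeta c p *m spin_rep gam false
    (conn_form D c p y).
    by rewrite /cov_spinor_coord spin_connE addrK.
  have -> : slash gam false (row x (Einv p *m conn_form D c p y))
      = theta x p *m spin_rep gam true (conn_form D c p y)
        - spin_rep gam false (conn_form D c p y) *m theta x p.
    by rewrite theta_spin_rep // addrC addKr.
  move: (theta x p) (theta y p) (slash _ _ _) (cov_zeta y p) (zeta c p) (xi c p)
    => tx ty sl Z z ps.
  move: (spin_rep _ _ _) (spin_rep _ _ _) (spin_rep _ _ _) (spin_rep _ _ _) =>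
    s1 s2 s3 s4.
  exact: second_derivative_algebra.
have [[ha Ea] [hb Eb]] := (H a b, H b a).
have := @pd_comm _ _ _ c _ (dom_open c) (@subset_refl _ _) _ _ (xi c) _ _ p a b dp
  (fun q dq => scomp_holo xi dq) (fun q dq => pd_xi a dq) (fun q dq =>
    pd_xi b dq) ha hb.
rewrite Ea Eb (row_christoffel_sym a b dp).
have -> : spin_rep gam true (Om a b p) = spin_rep gam true (pd c a (w b) p)
   - spin_rep gam true (pd c b (w a) p)
   + (spin_rep gam true (conn_form D c p b) *m spin_rep gam true (conn_form D c p a)
      - spin_rep gam true (conn_form D c p a) *m spin_rep gam true (conn_form D c p b)).
  rewrite (spin_rep_comm hgam) ?conn_form_skew // /curvature_of.
  by rewrite [LHS]linearD [X in X + _]linearB.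
move: (pd c a (w b) p) (pd c b (w a) p) => dab dba.
exact: commutator_algebra.
Qed.

End Integrability.

End Curvature.

(** * Curvature in the orthonormal frame *)

Lemma cyclic_mulmx (F : comPzRingType) k (K : 'I_k -> 'I_k -> 'M[F]_k) (M : 'M[F]_k) :
  (forall a b e d, K a b e d + K b e a d + K e a b d = 0) ->
  forall a b e d, (K a b *m M) e d + (K b e *m M) a d + (K e a *m M) b d = 0.
Proof.
move=> cyc a b e d; rewrite !mxE -!big_split big1 // => s _ /=.
by rewrite -!mulrDl cyc mul0r.
Qed.

Lemma cyclic_sum_mul (F : comPzRingType) (e1 e2 e3 x1 x2 x3 : F) :
  x1 + x2 + x3 = 0 -> e1 * e2 * e3 * x1 + e2 * e3 * e1 * x2 + e3 * e1 * e2 * x3 = 0.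
Proof. by move=> x0; rewrite -[RHS](mulr0 (e1 * e2 * e3)) -x0; ring. Qed.

Lemma scale_commutator (F : comPzRingType) l (e f k : F) (Za Zb : 'rV[F]_l)
    (ta tb : 'M[F]_l) :
  (e * f) *: (- 4%:R *: (k *: (Zb *m ta - Za *m tb)))
  = (4%:R * k) *: ((e *: Za) *m (f *: tb) - (f *: Zb) *m (e *: ta)).
Proof.
rewrite -!scalemxAl -!scalemxAr !scalerA; move: (Za *m tb) (Zb *m ta) => x y.
by apply/rowP => i; rewrite !mxE; ring.
Qed.

Section FrameCurvature.
Variables (R : realType) (m : nat) (X : complex_manifold R m.*2).
Variables (g : holo_metric X) (gam : gamma_family R m) (hgam : clifford gam).
Variables (S : spin_structure g gam) (D : levi_civita S).
Local Notation n := m.*2.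
Local Notation N := (sdim m).
Local Notation C := (Cplx R).
Variable c : chart X.

Local Notation E := (frame S c).
Local Notation Einv := (coframe S c).
Local Notation theta := (coframe_gam S c).
Local Notation Om := (curvature_of c (fun a q => conn_form D c q a)).

(** Only the direction indices of [Om] need conversion; its matrix indices already refer to the
    frame. *)
Definition riemann p al be x y : C :=
  \sum_a \sum_b (E p al a * E p be b) * Om a b p x y.

Lemma curvature_ofN (h : 'I_n -> X -> 'M[C]_n) a b p :
  curvature_of c h b a p = - curvature_of c h a b p.
Proof.
rewrite /curvature_of; move: (pd _ _ _ _) (pd _ _ _ _) (_ *m _) (_ *m _) => A B G H.
by rewrite opprD !opprB.
Qed.

Lemma riemannN12 p al be x y : riemann p be al x y = - riemann p al be x y.
Proof.
rewrite /riemann exchange_big -sumrN; apply: eq_bigr => a _; rewrite -sumrN.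
by apply: eq_bigr => b _; rewrite curvature_ofN mxE mulrN [E p be b * _]mulrC.
Qed.

Lemma riemannN34 p al be x y : dom c p -> riemann p al be y x = - riemann p al be x y.
Proof.
move=> dp; rewrite /riemann -sumrN; apply: eq_bigr => a _; rewrite -sumrN.
apply: eq_bigr => b _; rewrite -mulrN; congr (_ * _).
by have /matrixP/(_ x y) := conn_curvature_skew D a b dp; rewrite mxE [RHS]mxE.
Qed.

(** The cyclic identity is available for the Christoffel curvature; [frame_curvature] transfers it
    by turning the third index into a coordinate index. *)
Lemma riemann_bianchi p al be ga y : dom c p ->
  riemann p al be ga y + riemann p be ga al y + riemann p ga al be y = 0.
Proof.
move=> dp; pose K a b := curvature_of c (fun a q =>
  christoffel D c q a) a b p *m Einv p.
have OmE a b x : Om a b p x y = \sum_e E p x e * K a b e y.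
  rewrite -[Om a b p]mulmx1 -(metric_frame S dp)
    [Om a b p *m _]mulmxA frame_curvature //.
  by rewrite -mulmxA mxE.
have KB a b e : K a b e y + K b e a y + K e a b y = 0.
  exact: (cyclic_mulmx (Einv p) (fun a b e d => christoffel_bianchi D a b e d dp)).
have rE al' be' ga' : riemann p al' be' ga' y
    = \sum_a \sum_b \sum_e (E p al' a * E p be' b * E p ga' e) * K a b e y.
  apply: eq_bigr => a _; apply: eq_bigr => b _; rewrite OmE mulr_sumr.
  by apply: eq_bigr => e _; rewrite mulrA.
rewrite !rE [X in _ + X + _]sum3_rot [X in _ + _ + X]sum3_rot [X in _ + _ + X]sum3_rot.
rewrite -!big_split big1 // => a _; rewrite -!big_split big1 // => b _ /=.
rewrite -!big_split big1 // => e _ /=.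
exact: cyclic_sum_mul (KB a b e).
Qed.

Lemma frame_theta p be : dom c p -> \sum_b E p be b *: theta b p = gam false be.
Proof.
move=> dp; rewrite -[RHS]slash_delta.
have -> : delta_mx 0 be = \sum_b E p be b *: row b (Einv p).
  rewrite -[LHS]mulmx1 -(metric_frame S dp) -/(Einv p) mulmxA -rowE mulmx_sum_row.
  by apply: eq_bigr => b _; rewrite [row _ _ _ _]mxE.
by rewrite (linear_sum (slash gam false)); apply: eq_bigr => b _; apply/esym;
  exact: slashZ.
Qed.

Lemma spin_rep_sum (v : 'M[C]_n) (psi : 'rV[C]_N) :
  \sum_x \sum_y v x y *: (psi *m gam true x *m gam false y)
    = - 4%:R *: (psi *m spin_rep gam true v).
Proof.
rewrite /spin_rep mulmxN -scalemxAr -scaleNr scalerA mulrNN mulfV ?pnatr_eq0 // scale1r.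
rewrite mulmx_sumr; apply: eq_bigr => x _; rewrite mulmx_sumr; apply: eq_bigr => y _.
by rewrite -scalemxAr mulmxA.
Qed.

Variables (xi : spinor_field S true) (zeta : spinor_field S false) (k : C).
Hypothesis killing : forall p, dom c p -> forall al,
  cov_spinor D true c al (xi c) p = - k *: (zeta c p *m gam false al).
Local Notation cov_zeta a p := (cov_spinor_coord D false c a (zeta c) p).

(** The condition [spin_curvature] in the form required by [curvature_rho]; the 4 undoes the
    normalisation of [spin_rep]. *)
Lemma frame_spin_curvature p al be : dom c p ->
  \sum_x \sum_y riemann p al be x y *: (xi c p *m gam true x *m gam false y)
  = (4%:R * k) *: (cov_spinor D false c al (zeta c) p *m gam false be
                   - cov_spinor D false c be (zeta c) p *m gam false al).
Proof.
move=> dp.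
transitivity (\sum_a \sum_b (E p al a * E p be b) *:
   \sum_x \sum_y Om a b p x y *: (xi c p *m gam true x *m gam false y)).
  pose e x y := xi c p *m gam true x *m gam false y; rewrite -/(e _ _).
  transitivity (\sum_x \sum_y \sum_a \sum_b (E p al a * E p be b * Om a b p x y) *:
    e x y).
    apply: eq_bigr => x _; apply: eq_bigr => y _; rewrite scaler_suml;
      apply: eq_bigr => a _.
    by rewrite scaler_suml.
  under eq_bigr do rewrite exchange_big.
  rewrite exchange_big; apply: eq_bigr => a _ /=.
  under eq_bigr do rewrite exchange_big.
  rewrite exchange_big; apply: eq_bigr => b _ /=.
  rewrite scaler_sumr; apply: eq_bigr => x _; rewrite scaler_sumr;
    apply: eq_bigr => y _.
  by rewrite scalerA.
have F a b : (E p al a * E p be b) *: (\sum_x \sum_y Om a b p x y *: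
  (xi c p *m gam true x *m gam false y))
   = (4%:R * k) *: ((E p al a *: cov_zeta a p) *m (E p be b *: theta b p)
       - (E p be b *: cov_zeta b p) *m (E p al a *: theta a p)).
  rewrite spin_rep_sum (spin_curvature hgam killing) //.
  exact: scale_commutator.
under eq_bigr do under eq_bigr do rewrite F.
under eq_bigr do rewrite -scaler_sumr sumrB.
rewrite -scaler_sumr sumrB; congr (_ *: (_ - _)).
  rewrite -(frame_theta be dp) mulmx_suml; apply: eq_bigr => a _.
  by rewrite mulmx_sumr.
rewrite exchange_big /= -(frame_theta al dp) mulmx_suml; apply: eq_bigr => b _.
by rewrite mulmx_sumr.
Qed.

End FrameCurvature.

(** * The covariant derivative of zeta and its geodesy tensor *)

Section ZetaGeodesy.
Variables (R : realType) (m : nat) (X : complex_manifold R m.*2).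
Variables (g : holo_metric X) (gam : gamma_family R m) (hgam : clifford gam).
Variables (S : spin_structure g gam) (D : levi_civita S).
Local Notation n := m.*2.
Local Notation N := (sdim m).
Local Notation C := (Cplx R).
Variable c : chart X.

(** Needed since [zeta_of] is identified with a spinor field on chart domains only; these are open,
    so the derivatives agree there as well. *)
Lemma eq_geod_tensor b (psi phi : chart X -> X -> 'rV[C]_N) p A B E : dom c p ->
  (forall q, dom c q -> psi c q = phi c q) ->
  geod_tensor D b psi c p A B E = geod_tensor D b phi c p A B E.
Proof.
move=> dp H; have Hp : clmx gam b (psi c p) = clmx gam b (phi c p) by rewrite H.
have covE al : cov_tspinor D (~~ b) c al (fun q => clmx gam b (psi c q)) p
    = cov_tspinor D (~~ b) c al (fun q => clmx gam b (phi c q)) p.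
  apply: eq_bigr => a _; apply: (f_equal ( *:%R _)).
  apply: (f_equal2 (fun Y P : 'M[C]_(n, N) =>
    Y + (conn_form D c p a)^T *m P + P *m spin_conn D (~~ b) c p a) _ Hp).
  by apply: (dom_eq_pd _ dp) => q dq; rewrite H.
apply: eq_bigr => al _; apply: eq_bigr => be _.
exact: (f_equal2 (fun M P : 'M[C]_(n, N) => P al A * M be B * P be E) (covE al) Hp).
Qed.

Hypothesis m2 : (2 < m)%N.
Variables (xi : spinor_field S true) (zeta : spinor_field S false) (k : C).
Hypothesis k0 : k != 0.
Hypothesis killing : forall p, dom c p -> forall al,
  cov_spinor D true c al (xi c) p = - k *: (zeta c p *m gam false al).

Lemma cov_zeta_symmetric p : dom c p -> exists2 P : 'M[C]_n, P^T = P &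
  forall al, cov_spinor D false c al (zeta c) p
    = \sum_d P al d *: (xi c p *m gam true d).
Proof.
move=> dp; have k40 : 4%:R * k != 0 by rewrite mulf_neq0 // pnatr_eq0.
apply: (@curvature_rho _ _ _ hgam m2 (riemann D c p) _ _ _ (xi c p)
  (fun al => cov_spinor D false c al (zeta c) p) _ k40).
- by move=> *; exact: riemannN12.
- by move=> *; exact: riemannN34.
- by move=> *; exact: riemann_bianchi.
- by move=> al be; exact: frame_spin_curvature.
Qed.

Local Notation Phi p := (clmx gam false (zeta c p)).

Lemma geod_zeta p : dom c p -> star_at gam (xi c p) (zeta c p) ->
  exists2 Q : 'M[C]_N, Q^T = Q & forall A B E,
    geod_tensor D false zeta c p A B E
      = 2%:R * (xi c p 0 E * Q A B - xi c p 0 B * Q A E).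
Proof.
move=> dp [_ st]; have [P PT PE] := cov_zeta_symmetric dp.
exists ((Phi p)^T *m P *m Phi p); first by rewrite !trmx_mul trmxK PT mulmxA.
have PhiPsi E : row E ((Phi p)^T *m clmx gam true (xi c p))
  = (- 2%:R * xi c p 0 E) *: zeta c p.
  have -> : (Phi p)^T *m clmx gam true (xi c p) = - 2%:R *: ((xi c p)^T *m zeta c p).
    by rewrite -[LHS]trmxK trmx_mul trmxK st linearZ /= trmx_mul trmxK.
  by apply/rowP => A; rewrite !mxE big_ord1 !mxE mulrA.
(* The Clifford relation moves the [E]-th column of [Phi] next to [xi], where [PhiPsi], the
   transposed second equation of [star_at], evaluates it. *)
have term d E : xi c p *m gam true d *m slash gam false (row E (Phi p)^T)
   = 2%:R *: (xi c p 0 E *: (zeta c p *m gam false d) - Phi p d E *: xi c p).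
  rewrite -(slash_delta gam true d) -mulmxA (slashM hgam true)
    mulmxBr mulmxA slash_row PhiPsi.
  have -> : ((delta_mx 0 d : 'rV[C]_n) *m (row E (Phi p)^T)^T) 0 0 = Phi p d E.
    by rewrite dotC trmx_delta -colE [LHS]mxE [LHS]mxE [LHS]mxE.
  rewrite slash_delta mulmxN mul_mx_scalar -scalemxAl mulNr scaleNr opprK -!scalerA
    -scalerN -scalerDr.
  by rewrite addrC.
move=> A B E; rewrite geod_tensorE //; last exact: scomp_holo.
have F al : (cov_spinor D false c al (zeta c) p *m slash gam false (row E (Phi p)^T))
  0 B
   = 2%:R * (xi c p 0 E * (P *m Phi p) al B - xi c p 0 B * (P *m Phi p) al E).
  rewrite PE mulmx_suml summxE ![(P *m _) al _]mxE !mulr_sumr -sumrB mulr_sumr.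
  apply: eq_bigr => d _; rewrite -scalemxAl term.
  have -> : Phi p d B = (zeta c p *m gam false d) 0 B by exact: clmxE.
  move: (zeta c p *m gam false d) (Phi p d E) => u x.
  by rewrite !mxE; ring.
under eq_bigr do rewrite F.
rewrite -!mulmxA ![((Phi p)^T *m _) A _]mxE !mulr_sumr -sumrB mulr_sumr.
apply: eq_bigr => al _; rewrite ![(Phi p)^T A al]mxE.
move: (Phi p al A) ((P *m Phi p) al B) ((P *m Phi p) al E) => x y z.
ring.
Qed.

(** Every term is a component of [xi] times one of the symmetric [Q], so skew-symmetrisation
    annihilates it. *)
Lemma skew3_geod_zeta p A B E : dom c p -> star_at gam (xi c p) (zeta c p) ->
  skew3 (geod_tensor D false zeta c p) A B E = 0.
Proof.
move=> dp st; have [Q QT QE] := geod_zeta dp st; rewrite /skew3 !QE.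
have QS x y : Q x y = Q y x by rewrite -{1}QT mxE.
rewrite (QS B A) (QS E A) (QS E B); ring.
Qed.

End ZetaGeodesy.

(** * From the pointwise statements to the spinor fields *)

Lemma trmx_mulE (F : pzSemiRingType) k l r (A : 'M[F]_(k, l)) (B : 'M[F]_(k, r)) i j :
  (A^T *m B) i j = \sum_s A s i * B s j.
Proof. by rewrite mxE; apply: eq_bigr => s _; rewrite mxE. Qed.

Lemma star_atP (R : realType) m (gam : gamma_family R m)
    (xi zeta : 'rV[Cplx R]_(sdim m)) :
  star_at gam xi zeta <->
  (forall A B, \sum_al clmx gam false zeta al A * clmx gam false zeta al B = 0)
  /\ (forall A B, \sum_al clmx gam true xi al B * clmx gam false zeta al A
      = - 2%:R * zeta 0 B * xi 0 A).
Proof.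
have zx A B : (- 2%:R *: (zeta^T *m xi)) B A = - 2%:R * zeta 0 B * xi 0 A.
  by rewrite mxE trmx_mulE big_ord1 mulrA.
split=> [[H1 H2]|[H1 H2]]; split.
- by move=> A B; rewrite -trmx_mulE H1 mxE.
- by move=> A B; rewrite -trmx_mulE H2 zx.
- by apply/matrixP => A B; rewrite trmx_mulE H1 mxE.
- by apply/matrixP => A B; rewrite trmx_mulE H2 zx.
Qed.

Theorem proposition5p20 (R : realType) (m : nat) (hm : (2 < m)%N)
    (X : complex_manifold R m.*2) (g : holo_metric X)
    (gam : gamma_family R m) (hgam : clifford gam)
    (S : spin_structure g gam) (D : levi_civita S)
    (xi : spinor_field S true) (hpure : pure_field xi)
    (hck : conformal_killing D xi) :
  let zeta := zeta_of D xi in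
  [/\ forall c p, dom c p -> forall A B E,
        sym12 (geod_tensor D true xi c p) A B E = 0,
      (geodetic D xi <-> star gam xi zeta)
      /\ (totally_geodetic D xi <-> star gam xi zeta),
      star gam xi zeta <-> pure_and_incident gam xi zeta
    & geodetic D xi ->
      forall c p, dom c p -> forall A B E,
        skew3 (geod_tensor D false zeta c p) A B E = 0].
Proof.
have m0 : (0 < m)%N by exact: leq_ltn_trans hm.
have [z kil] := hck => zeta.
have zE c p : dom c p -> zeta c p = z c p.
  by move=> dp; rewrite /zeta (zeta_ofE hgam m0 (kil c)).
have starE : star gam xi zeta <-> forall c p, dom c p -> star_at gam (xi c p) (z c p).
  by split=> H c p dp; [have := H c p dp; rewrite zE // => /star_atP | rewrite zE //;
    exact/star_atP/H].
have geodE : geodetic D xi <-> forall c p, dom c p -> star_at gam (xi c p) (z c p).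
  split=> H c p dp; first by apply/(star_atE hgam m0 (kil c) (hpure c) dp)/(H c p dp).
  by apply/(star_atE hgam m0 (kil c) (hpure c) dp)/H.
split.
- by move=> c p dp A B E; exact: (geod_xi_sym hgam (kil c) (hpure c)).
- split; first exact: iff_trans geodE (iff_sym starE).
  apply: iff_trans _ (iff_sym starE); split=> [H c p dp|H c U Uo Ud Y Z nY nZ p Up].
    (* Total geodesy is applied to the columns of xi_a^A over the whole chart domain. *)
    apply: (totally_geodetic_star hgam m0 (kil c) (hpure c) dp) => A E.
    apply: (H c (dom c) (dom_open c) (@subset_refl _ _) (fun q =>
      row A (clmx gam true (xi c q))^T)
      (fun q => row E (clmx gam true (xi c q))^T) _ _ p dp);
      exact: (row_null_section hgam (hpure c)).
  by apply: (star_totally_geodetic hgam (kil c) (hpure c) Uo Ud (H c p (Ud _ Up))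
    nY nZ Up).
- apply: iff_trans starE _; split=> H c p dp.
    rewrite zE // => z0; exact: (star_incident hgam m0 (hpure c p dp) (H c p dp) z0).
  apply: (incident_star hgam m0 (hpure c p dp)); rewrite -zE //; exact: H.
- move=> /geodE st c p dp A B E.
  have k0 : (sqrtC (2%:R : Cplx R))^-1 != 0 by rewrite invr_eq0 sqrtC_eq0 pnatr_eq0.
  have eqg A' B' E' := @eq_geod_tensor _ _ _ _ _ _ D c false zeta z p A' B' E' dp (zE
    c).
  rewrite -(skew3_geod_zeta hgam hm k0 (fun p dp al =>
    cov_xi (kil c) al dp) A B E dp (st c p dp)).
  by rewrite /skew3 !eqg.
Qed.
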